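(* Suppose $(X,d,\mu)$ is an Ahlfors regular space with dimension $Q$. Given $0<\alpha<Q$, let $p(\cdot):X\to[1,+\infty)$ be a measurable function such that $p(\cdot)\in LH$ and $1<p_-\leq p_+<Q/\alpha$. Define $q(\cdot)$ by $1/p(\cdot)-1/q(\cdot)=\alpha/Q$. Then there exists $C=C(p(\cdot),Q,\alpha,X)$ such that for all $f\in L^{p(\cdot)}(X)$, $$\|I_\alpha^* f\|_{q(\cdot)}\leq C\|f\|_{p(\cdot)}.$$ The same inequality also holds with $I_\alpha^*$ replaced by $I_\alpha^{**}$.
   Context: A quasi-metric space $(X,d)$ is a set $X$ with $d:X\times X\to[0,\infty)$ such that $d(x,y)=0$ iff $x=y$, $d(x,y)=d(y,x)$, and $d(x,y)\le A_0(d(x,z)+d(y,z))$ for all $x,y,z$ and some constant $A_0\ge1$. Write $B(x,r)$ for the ball with center $x$ and radius $r$. Here $\mu$ is a positive measure defined on the $\sigma$-algebra generated by quasi-metric balls and open sets. $(X,d,\mu)$ is Ahlfors regular with dimension $Q>0$ if $(X,d)$ is a quasi-metric space and there are constants $C_1,C_2>0$ such that for every $x\in X$ and $r>0$, $C_1r^Q\le\mu(B(x,r))\le C_2r^Q$ (in particular $\mu(X)=+\infty$). Operators: for $0<\alpha<Q$, $$I_\alpha^* f(x)=\int_X\frac{f(y)}{d(x,y)^{Q-\alpha}}\,d\mu(y),\qquad I_\alpha^{**} f(x)=\int_X\frac{f(y)\,d(x,y)^\alpha}{\mu(B(x,d(x,y)))}\,d\mu(y).$$ Variable Lebesgue spaces: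 for measurable $p(\cdot):X\to[1,\infty]$ let $\Omega_\infty^{p(\cdot)}=\{x\in X:p(x)=\infty\}$ and $$\rho_{p(\cdot)}(f)=\int_{X\setminus\Omega_\infty^{p(\cdot)}}|f(x)|^{p(x)}\,d\mu(x)+\|f\|_{L^\infty(\Omega_\infty^{p(\cdot)})}.$$ $L^{p(\cdot)}(X)$ is the set of measurable $f$ with $\rho_{p(\cdot)}(f/\lambda)<\infty$ for some $\lambda>0$, with norm $\|f\|_{p(\cdot)}=\inf\{\lambda>0:\rho_{p(\cdot)}(f/\lambda)\le1\}$. Put $p_-=\operatorname{ess\,inf}_{x\in X}p(x)$ and $p_+=\operatorname{ess\,sup}_{x\in X}p(x)$. Log-Hölder conditions: for $r(\cdot):X\to[0,\infty)$, $r(\cdot)\in LH_0$ if there is $C_0$ with $|r(x)-r(y)|\le \frac{-C_0}{\log d(x,y)}$ for all $x\neq y$ in $X$ with $d(x,y)<1/2$. $r(\cdot)\in LH_\infty$ (with respect to a base point $x_0\in X$; the choice of base point is immaterial up to changing the constant) if there are constants $C_\infty,r_\infty$ with $|r(x)-r_\infty|\le\frac{C_\infty}{\log(e+d(x,x_0))}$ for all $x\in X$. $LH=LH_0\cap LH_\infty$. *)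

(* Defs.v *)
From HB Require Import structures.
From mathcomp Require Import all_boot all_order all_algebra.
From mathcomp Require Import all_classical all_reals all_analysis.
From mathcomp Require Import measurable_realfun ess_sup_inf.

Set Implicit Arguments.
Unset Strict Implicit.
Unset Printing Implicit Defensive.

Import Order.TTheory GRing.Theory Num.Theory.
Import numFieldNormedType.Exports.

Local Open Scope classical_set_scope.
Local Open Scope ring_scope.

Definition is_quasi_metric (R : realType) (X : Type) (dist : X -> X -> R) :=
  [/\ forall x y, 0 <= dist x y,
      forall x y, dist x y = 0 <-> x = y,
      forall x y, dist x y = dist y x &
      exists2 A0 : R, 1 <= A0 &
        forall x y z, dist x y <= A0 * (dist x z + dist y z)].

Definition qball (R : realType) (X : Type) (dist : X -> X -> R) (x : X) (r : R)
  : set X := [set y | dist x y < r].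

(* The topology of a quasi-metric; the balls themselves need not be open. *)
Definition qopen (R : realType) (X : Type) (dist : X -> X -> R) (U : set X) :=
  forall x, U x -> exists2 r : R, 0 < r & qball dist x r `<=` U.

Definition quasi_metric_sigma_algebra (R : realType) (X : Type)
    (dist : X -> X -> R) : set (set X) :=
  <<s [set B | exists x, exists2 r : R, 0 < r & B = qball dist x r]
      `|` [set U | qopen dist U] >>.

Definition ahlfors_regular (R : realType) (disp : measure_display)
    (X : measurableType disp) (dist : X -> X -> R)
    (mu : {measure set X -> \bar R}) (Q : R) :=
  [/\ is_quasi_metric dist,
      disp.-measurable = quasi_metric_sigma_algebra dist,
      0 < Q &
      exists C1 C2 : R, [/\ 0 < C1, 0 < C2 &
        forall (x : X) (r : R), 0 < r ->
          ((C1 * r `^ Q)%:E <= mu (qball dist x r) <= (C2 * r `^ Q)%:E)%E]].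

(* Division is that of \bar R, so the kernel is +oo on the diagonal y = x. *)
Definition Istar (R : realType) (disp : measure_display)
    (X : measurableType disp) (dist : X -> X -> R)
    (mu : {measure set X -> \bar R}) (Q alpha : R) (f : X -> \bar R) (x : X)
  : \bar R :=
  (\int[mu]_y (f y / (dist x y `^ (Q - alpha))%:E))%E.

Definition Istarstar (R : realType) (disp : measure_display)
    (X : measurableType disp) (dist : X -> X -> R)
    (mu : {measure set X -> \bar R}) (alpha : R) (f : X -> \bar R) (x : X)
  : \bar R :=
  (\int[mu]_y (f y * (dist x y `^ alpha)%:E / mu (qball dist x (dist x y))))%E.

Section variable_lebesgue.
Context (R : realType) (disp : measure_display) (X : measurableType disp).
Variables (mu : {measure set X -> \bar R}) (p : X -> \bar R).

Definition Omega_infty : set X := [set x | p x = +oo%E].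

(* Extending f by 0 outside Omega_infty leaves the essential supremum of |f|
   over Omega_infty unchanged, and gives 0 when Omega_infty is empty. *)
Definition vmodular (f : X -> \bar R) : \bar R :=
  (\int[mu]_(x in ~` Omega_infty) (`|f x| `^ fine (p x))
   + Lnorm mu +oo (f \_ Omega_infty))%E.

Definition vscale (f : X -> \bar R) (lambda : R) (x : X) : \bar R :=
  (f x * (lambda^-1)%:E)%E.

Definition vLebesgue : set (X -> \bar R) :=
  [set f : X -> \bar R | measurable_fun [set: X] f /\
     exists2 lambda : R, 0 < lambda & (vmodular (vscale f lambda) < +oo)%E].

(* The value is +oo when no lambda is admissible. *)
Definition vnorm (f : X -> \bar R) : \bar R :=
  ereal_inf [set lambda%:E | lambda in
    [set lambda : R | 0 < lambda /\ (vmodular (vscale f lambda) <= 1)%E]].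

End variable_lebesgue.

Definition LH0 (R : realType) (X : Type) (dist : X -> X -> R) (r : X -> R) :=
  exists C0 : R, forall x y, x <> y -> dist x y < 1 / 2 ->
    `|r x - r y| <= - C0 / ln (dist x y).

Definition LHinfty (R : realType) (X : Type) (dist : X -> X -> R) (x0 : X)
    (r : X -> R) :=
  exists Cinfty rinfty : R, forall x,
    `|r x - rinfty| <= Cinfty / ln (expR 1 + dist x x0).

Definition LH (R : realType) (X : Type) (dist : X -> X -> R) (x0 : X)
    (r : X -> R) :=
  LH0 dist r /\ LHinfty dist x0 r.

(* Main.v *)
Require Import Defs.
From HB Require Import structures.
From mathcomp Require Import all_boot all_order all_algebra.
From mathcomp Require Import all_classical all_reals all_analysis.
From mathcomp Require Import measurable_realfun ess_sup_inf ring lra zify.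

Set Implicit Arguments.
Unset Strict Implicit.
Unset Printing Implicit Defensive.

Import Order.TTheory GRing.Theory Num.Theory.
Import numFieldNormedType.Exports.

Local Open Scope classical_set_scope.
Local Open Scope ring_scope.

(* The kernel is compared with a sum over dyadic scales: with [A_k f x] the
   average of [f] over the ball of radius [2 ^ k] (normalised by [2 ^ (k Q)]),
   the potential of [f] is at most a constant times the sum over the integers
   [k] of [2 ^ (k alpha) * A_k f x].  Since the [A_k f] are dominated by a
   maximal function and also decay like [2 ^ (- k Q / p)], the sum is at most a
   power of the maximal function (Hedberg's trick), and everything reduces to
   the L^s bound of the maximal function for one constant exponent [s > 1].
   If [f] has modular at most 1, split it at height 1.  On small scales the
   part above 1 satisfies [(A_k f) ^ (p x) <= C (A_k (f ^ (p / s))) ^ s] by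
   local log-Hoelder continuity of [p]; on large scales it behaves like a
   function of L^s.  The part below 1 is comparable with a function of
   [L^pinf] up to an integrable error, by the decay condition at infinity.
   Joint measurability of [dist] is not available, so potentials need not be
   measurable: they are only ever bounded pointwise by measurable functions. *)

(** * Integrals of nonmeasurable functions and sums over the integers *)

(** Since the exponent changes from point to point, modulars are compared, not norms. The exponents
    close up as follows: if the averages at [x] are at most [a] and at most [2 ^ (- k Q / p x)], the
    two bounds cross at one scale and the sum is of order [a ^ (1 - alpha p x / Q)], which is
    [a ^ (p x / q x)]; with [a] equal to [m ^ (s / p x)], its power [q x] is [m ^ s], where the
    exponent no longer depends on [x]. The power [p / s] is chosen because [f ^ (p / s)] lies in L^s
    with [s > 1]. Height 1 is the natural cut because enlarging an exponent increases values above 1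
    and decreases those below. Below 1 the exponent is frozen at [pinf]; the resulting mismatch
    [w ^ (p x - pinf)] is harmless as long as [w] is not smaller than a fixed negative power of the
    distance to [x0]. This is why the integrable function [(e + dist x x0) ^ (- (Q + 1))] is added
    to the majorants. *)

Section nonmeasurable_integral.
Context d (T : measurableType d) (R : realType) (mu : {measure set T -> \bar R}).
Local Open Scope ereal_scope.

(* The library version requires measurability; monotonicity of the supremum
   over simple functions does not. *)
Lemma ge0_le_integral_nonmeas (f g : T -> \bar R) :
  (forall x, 0 <= f x) -> (forall x, f x <= g x) ->
  \int[mu]_x f x <= \int[mu]_x g x.
Proof.
move=> f0 fg; have g0 x : 0 <= g x by exact: le_trans (f0 x) (fg x).
rewrite !ge0_integralTE//; apply: ereal_sup_le => _ [h hf <-].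
by exists h => // x; exact: le_trans (hf x) (fg x).
Qed.

Lemma abse_integral_le (f g : T -> \bar R) :
  (forall x, `|f x| <= g x) -> `|\int[mu]_x f x| <= \int[mu]_x g x.
Proof.
move=> fg; have g0 x : 0 <= g x by exact: le_trans (fg x).
rewrite integralE.
have le1 : \int[mu]_x f^\+ x <= \int[mu]_x g x.
  apply: ge0_le_integral_nonmeas => // x.
  by rewrite funeposE ge_max g0 (le_trans (lee_abs _) (fg x)).
have le2 : \int[mu]_x f^\- x <= \int[mu]_x g x.
  apply: ge0_le_integral_nonmeas => // x.
  by rewrite funenegE ge_max g0 (le_trans (lee_abs _))// abseN.
have p0 : 0 <= \int[mu]_x f^\+ x by apply: integral_ge0.
have n0 : 0 <= \int[mu]_x f^\- x by apply: integral_ge0.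
move: p0 n0 le1 le2; move: (\int[mu]_x f^\+ x) (\int[mu]_x f^\- x) (\int[mu]_x g x).
move=> [a| |] [b| |] [c| |]//=; rewrite ?lee_fin ?leey//.
by move=> a0 b0 ac bc; rewrite ler_norml; lra.
Qed.

End nonmeasurable_integral.

Section zsum.
Context {R : realType}.
Local Open Scope ereal_scope.

Definition zsum (a : int -> \bar R) :=
  \sum_(0 <= n <oo) a (Posz n) + \sum_(0 <= n <oo) a (Negz n).

Lemma nneseries_ge_term (a : nat -> \bar R) n : (forall k, 0 <= a k) ->
  a n <= \sum_(0 <= k <oo) a k.
Proof.
move=> a0; rewrite (nneseriesD1 (n := n))//.
by rewrite leeDl//; apply: nneseries_ge0.
Qed.

Lemma nneseries_telescope (a : nat -> \bar R) (phi : nat -> R) (M : R) :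
  (forall k, 0 <= a k) -> (forall k, a k <= (phi k.+1 - phi k)%:E) ->
  (forall k, phi k <= M)%R -> \sum_(0 <= k <oo) a k <= (M - phi 0%N)%:E.
Proof.
move=> a0 aphi phiM; apply: lime_le; first by apply: is_cvg_nneseries.
near=> n; rewrite (@le_trans _ _ (phi n - phi 0%N)%:E)//; last first.
  by rewrite lee_fin lerB.
elim: (n) => [|m ih]; first by rewrite big_geq// subrr.
rewrite big_nat_recr//= (le_trans (leeD ih (aphi m)))// -EFinD lee_fin; lra.
Unshelve. all: by end_near. Qed.

Variables (a b : int -> \bar R) (a0 : forall k, 0 <= a k).

Lemma zsum_ge0 : 0 <= zsum a.
Proof. by rewrite adde_ge0//; apply: nneseries_ge0. Qed.

Lemma zsum_ge_term k : a k <= zsum a.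
Proof.
case: k => n.
- apply: (le_trans (nneseries_ge_term (a := fun n => a (Posz n)) n _)) => //.
  by rewrite leeDl//; apply: nneseries_ge0.
- apply: (le_trans (nneseries_ge_term (a := fun n => a (Negz n)) n _)) => //.
  by rewrite leeDr//; apply: nneseries_ge0.
Qed.

Lemma le_zsum : (forall k, a k <= b k) -> zsum a <= zsum b.
Proof. by move=> ab; apply: leeD; apply: lee_nneseries. Qed.

Lemma zsumZl (c : R) : (0 <= c)%R -> zsum (fun k => c%:E * a k) = c%:E * zsum a.
Proof.
move=> c0; rewrite /zsum !nneseriesZl// ge0_muleDr//; apply: nneseries_ge0 => //.
Qed.

Lemma zsum_telescope (phi : int -> R) (M : R) :
  (forall k, a k <= (phi (k + 1)%R - phi k)%:E) ->
  (forall k, 0 <= phi k <= M)%R -> zsum a <= M%:E.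
Proof.
move=> aphi phiM; rewrite /zsum.
(* The nonnegative indices contribute at most [M - phi 0]; along the negative ones [- phi (- n)]
   rises from [- phi 0] and stays at most 0, which contributes at most [phi 0]. *)
have -> : M = ((M - phi (Posz 0)) + (0 - - phi (Posz 0)))%R by ring.
rewrite EFinD; apply: leeD.
- apply: (@nneseries_telescope _ (fun n => phi (Posz n))) => //.
  + by move=> k; rewrite -addn1 PoszD.
  + by move=> k; have /andP[] := phiM (Posz k).
- apply: (@nneseries_telescope _ (fun n => - phi (- Posz n)%R))%R => //.
  + move=> k; rewrite (le_trans (aphi _))// lee_fin NegzE opprK addrC.
    by rewrite -addn1 PoszD opprD subrK.
  + by move=> k; have /andP[] := phiM (- Posz k)%R; rewrite oppr_le0.
Qed.

End zsum.

Lemma zsumD {R : realType} (a b : int -> \bar R) :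
  (forall k, 0 <= a k)%E -> (forall k, 0 <= b k)%E ->
  (zsum (fun k => a k + b k) = zsum a + zsum b)%E.
Proof.
move=> a0 b0; rewrite /zsum !nneseriesD// addeACA//.
Qed.

Lemma integral_zsum d (T : measurableType d) (R : realType)
    (mu : {measure set T -> \bar R}) (f : int -> T -> \bar R) :
  (forall k, measurable_fun setT (f k)) -> (forall k x, 0 <= f k x)%E ->
  (\int[mu]_x zsum (fun k => f k x) = zsum (fun k => \int[mu]_x f k x))%E.
Proof.
move=> mf f0; rewrite ge0_integralD//=.
- by rewrite !integral_nneseries.
- by move=> x _; apply: nneseries_ge0.
- by apply: ge0_emeasurable_sum => //.
- by move=> x _; apply: nneseries_ge0.
- by apply: ge0_emeasurable_sum => //.
Qed.

Lemma measurable_zsum d (T : measurableType d) (R : realType)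
    (f : int -> T -> \bar R) :
  (forall k, measurable_fun setT (f k)) -> (forall k x, 0 <= f k x)%E ->
  measurable_fun setT (fun x => zsum (fun k => f k x)).
Proof.
move=> mf f0; apply: emeasurable_funD; exact: ge0_emeasurable_sum.
Qed.

(** * Dyadic sums *)

Section dyadic.
Context {R : realType}.

Definition dyadr (k : int) : R := 2 ^ k.

Lemma dyadr_gt0 k : 0 < dyadr k. Proof. by rewrite exprz_gt0. Qed.

Lemma dyadrS k : dyadr (k + 1) = 2 * dyadr k.
Proof. by rewrite /dyadr expfzDr// expr1z mulrC. Qed.

Lemma dyadr_powR k : dyadr k = 2 `^ k%:~R.
Proof. by rewrite powR_intmul. Qed.

Lemma le_dyadr k l : (k <= l)%R -> dyadr k <= dyadr l.
Proof. by move=> kl; rewrite !dyadr_powR ler_powR ?ler1n// ler_int. Qed.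

Lemma dyadr_itv (v : R) : 0 < v -> exists k, dyadr k <= v < dyadr (k + 1).
Proof.
move=> v0; exists (Num.floor (ln v / ln 2)).
have l2 : 0 < ln 2 :> R by rewrite ln_gt0// ltr1n.
have vE : v = 2 `^ (ln v / ln 2).
  by rewrite /powR pnatr_eq0/= divfK ?gt_eqF// lnK.
rewrite !dyadr_powR {2 3}vE ler_powR ?ler1n ?floor_le//=.
by rewrite /powR pnatr_eq0/= ltr_expR ltr_pM2r// floorD1_gt.
Qed.

Lemma powR2_gt1 (b : R) : 0 < b -> 1 < 2 `^ b.
Proof.
move=> b0; have l2 : 0 < ln 2 :> R by rewrite ln_gt0// ltr1n.
by rewrite /powR pnatr_eq0/= -[X in X < _]expR0 ltr_expR mulr_gt0.
Qed.

Lemma dyadrSX k (b : R) : dyadr (k + 1) `^ b = 2 `^ b * dyadr k `^ b.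
Proof. by rewrite dyadrS powRM// ltW// dyadr_gt0. Qed.

Lemma le_powR2r (b x y : R) : 0 <= b -> 0 <= x -> x <= y -> x `^ b <= y `^ b.
Proof. by move=> b0 x0 xy; rewrite ge0_ler_powR// nnegrE// (le_trans x0). Qed.

Lemma le_powR2rN (b x y : R) : 0 <= b -> 0 < x -> x <= y ->
  y `^ (- b) <= x `^ (- b).
Proof.
move=> b0 x0 xy; rewrite !powRN lef_pV2 ?posrE ?powR_gt0//.
  by rewrite le_powR2r// ltW.
exact: lt_le_trans xy.
Qed.

Lemma geometric_sum_up (b v : R) : 0 < b -> 0 <= v ->
  (zsum (fun k => (if dyadr k < v then dyadr k `^ b else 0)%:E)
   <= ((2 `^ b - 1)^-1 * (2 * v) `^ b)%:E)%E.
Proof.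
move=> b0 v0; have c0 := powR2_gt1 b0.
set K := (2 `^ b - 1)^-1; have K0 : 0 < K by rewrite invr_gt0 subr_gt0.
(* The cut at [2 * v] bounds the telescoping function, yet for [dyadr k < v] it affects neither
   [dyadr k] nor its double, so [K] makes the increment exactly [dyadr k ^ b]. *)
apply: (@zsum_telescope _ _ _ (fun k => K * (Num.min (dyadr k) (2 * v)) `^ b)).
- by move=> k; rewrite lee_fin; case: ifP => // _; exact: powR_ge0.
- move=> k; rewrite lee_fin; case: ifP => [kv|_]; last first.
    rewrite subr_ge0 ler_pM2l// le_powR2r//; first exact: ltW.
      by rewrite le_min ltW ?dyadr_gt0//=; lra.
    rewrite le_min ge_min le_dyadr ?ge_min ?lexx ?orbT//.
    by rewrite lerDl.
  have ? := dyadr_gt0 k.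
  rewrite dyadrS !min_l; [|lra|lra].
  rewrite powRM ?(ltW (dyadr_gt0 _))// -mulrBr -[X in _ - X]mul1r -mulrBl mulrA.
  by rewrite mulVf ?mul1r// gt_eqF// subr_gt0.
- move=> k; rewrite mulr_ge0 ?powR_ge0 ?(ltW K0)//= ler_pM2l// le_powR2r//.
  + exact: ltW.
  + by rewrite le_min ltW ?dyadr_gt0//=; lra.
  + by rewrite ge_min lexx orbT.
Qed.

Lemma geometric_sum_down (b v : R) : 0 < b -> 0 < v ->
  (zsum (fun k => (if v <= dyadr k then dyadr k `^ (- b) else 0)%:E)
   <= ((1 - 2 `^ (- b))^-1 * v `^ (- b))%:E)%E.
Proof.
move=> b0 v0; have c0 : 2 `^ (- b) < 1 :> R.
  by rewrite powRN invf_lt1 ?powR2_gt1// powR_gt0.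
set K := (1 - 2 `^ (- b))^-1; have K0 : 0 < K by rewrite invr_gt0 subr_gt0.
(* The mirror image: the scale is frozen below [v], and subtracting from [v ^ (- b)] turns the
   decreasing powers into a nonnegative function bounded by [K * v ^ (- b)]. *)
apply: (@zsum_telescope _ _ _
  (fun k => K * (v `^ (- b) - (Num.max (dyadr k) v) `^ (- b)))).
- by move=> k; rewrite lee_fin; case: ifP => // _; exact: powR_ge0.
- move=> k; have ? := dyadr_gt0 k; rewrite lee_fin -mulrBr.
  case: ifP => [kv|_]; last first.
    apply: mulr_ge0; first exact: ltW.
    have := @le_powR2rN b (Num.max (dyadr k) v) (Num.max (dyadr (k + 1)) v) (ltW b0).
    rewrite lt_max v0 orbT => /(_ isT); rewrite ge_max !le_max lexx orbT dyadrS.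
    have -> : dyadr k <= 2 * dyadr k by lra.
    by move=> /(_ isT); lra.

  rewrite dyadrS !max_l//; last by lra.
  rewrite powRM ?(ltW (dyadr_gt0 _))//.
  rewrite [X in _ <= K * X](_ : _ = (1 - 2 `^ (- b)) * dyadr k `^ (- b)); last by ring.
  by rewrite mulrA mulVf ?mul1r// gt_eqF// subr_gt0.
- move=> k; have xv : v <= Num.max (dyadr k) v by rewrite le_max lexx orbT.
  rewrite mulr_ge0 ?(ltW K0) ?subr_ge0 ?le_powR2rN ?(ltW b0)//=.
  by rewrite ler_pM2l// gerBl powR_ge0.
Qed.

(* The crossover scale is [v = a `^ (- 1 / t)]. *)
Lemma hedberg_sum (al t t0 a : R) : 0 < al -> al < t0 -> t0 <= t -> 0 < a ->
  (zsum (fun k => (dyadr k `^ al * Num.min a (dyadr k `^ (- t)))%:E)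
   <= ((2 `^ al / (2 `^ al - 1) + (1 - 2 `^ (- (t0 - al)))^-1)
        * a `^ (1 - al / t))%:E)%E.
Proof.
move=> al0 alt0 t0t a0; have t_gt0 : 0 < t by lra.
pose v := a `^ (- t^-1); have v0 : 0 < v by exact: powR_gt0.
have H : (zsum (fun k => (dyadr k `^ al * Num.min a (dyadr k `^ (- t)))%:E) <=
  zsum (fun k => a%:E * (if dyadr k < v then dyadr k `^ al else 0)%:E +
     (if v <= dyadr k then dyadr k `^ (- (t - al)) else 0)%:E))%E.
  apply: le_zsum => k.
    by rewrite lee_fin mulr_ge0 ?powR_ge0// le_min ltW//= powR_ge0.
  rewrite -EFinM -EFinD lee_fin; case: ltP => _.
    by rewrite addr0 mulrC ler_pM2r ?powR_gt0 ?dyadr_gt0// ge_min lexx.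
  rewrite mulr0 add0r opprB powRD; last by apply/implyP => _; rewrite gt_eqF ?dyadr_gt0.
  by rewrite ler_pM2l ?powR_gt0 ?dyadr_gt0// ge_min lexx orbT.
have p1 k : (0 <= (if dyadr k < v then dyadr k `^ al else 0)%:E :> \bar R)%E.
  by rewrite lee_fin; case: ifP => // _; exact: powR_ge0.
have p2 k : (0 <= (if v <= dyadr k then dyadr k `^ (- (t - al)) else 0)%:E :> \bar R)%E.
  by rewrite lee_fin; case: ifP => // _; exact: powR_ge0.
apply: (le_trans H); rewrite zsumD//; last first.
  by move=> k; apply: mule_ge0 => //; rewrite lee_fin ltW.
rewrite zsumZl ?(ltW a0)//.
have tal0 : 0 < t - al by lra.
have aE0 : (0 <= a%:E)%E by rewrite lee_fin ltW.
apply: (le_trans (leeD (lee_wpmul2l aE0 (geometric_sum_up al0 (ltW v0)))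
  (geometric_sum_down tal0 v0))).
rewrite -EFinM -EFinD lee_fin [leRHS]mulrDl; apply: lerD.
  rewrite powRM ?(ltW v0)// /v -powRrM.
  rewrite [X in _ <= X](_ : _ = a * a `^ (- (al / t)) * (2 `^ al / (2 `^ al - 1))).
    rewrite mulNr [t^-1 * al]mulrC le_eqVlt; apply/orP; left; apply/eqP; ring.
  rewrite powRD; last by apply/implyP => _; rewrite gt_eqF.
  rewrite powRr1 ?(ltW a0)//; ring.
rewrite /v -powRrM mulrNN.
have -> : t^-1 * (t - al) = 1 - al / t by field; rewrite gt_eqF.
rewrite ler_pM2r ?powR_gt0//.
(* Only a lower bound [t0] of [t] enters the constant, which thus stays uniform when [t] is
   [Q / p x] with [x] varying. *)
have h x : 0 < x -> 0 < 1 - 2 `^ (- x) :> R.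
  by move=> x0; rewrite subr_gt0 powRN invf_lt1 ?powR2_gt1// powR_gt0.
have t0al : 0 < t0 - al by lra.
rewrite lef_pV2 ?posrE ?h//.
rewrite lerB// !powRN lef_pV2 ?posrE ?powR_gt0// ler_powR ?ler1n//; lra.
Qed.

End dyadic.

(** * Vitali selection *)

Section vitali_selection.
Context {T I : Type} (B : I -> set T) (lev : I -> nat) (D : set I).

(** Lower levels are served first and will be the larger balls. Candidates avoid everything kept so
    far, so that adding a maximal disjoint family of them preserves disjointness. *)
Let next (U : set I) n : set I :=
  [set i | [/\ D i, lev i = n & forall j, U j -> B i `&` B j = set0]].

Fixpoint vitali_select n : set I :=
  if n is m.+1 then
    vitali_select m `|`
      sval (ex_maximal_disjoint_subcollection B (next (vitali_select m) m))
  else set0.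

Let nextP U n :
  maximal_disjoint_subcollection B
    (sval (ex_maximal_disjoint_subcollection B (next U n))) (next U n).
Proof. by case: ex_maximal_disjoint_subcollection. Qed.

Let select_mono m n : (m <= n)%N -> vitali_select m `<=` vitali_select n.
Proof.
elim: n => [|n ih]; first by rewrite leqn0 => /eqP ->.
rewrite leq_eqVlt ltnS => /predU1P[->//|/ih h]; apply: subset_trans h _ => /=.
exact: subsetUl.
Qed.

Let select_sub n : vitali_select n `<=` D.
Proof.
elim: n => [//|n ih] i /= [/ih//|].
by have [h _ _] := nextP (vitali_select n) n; move=> /h[].
Qed.

Let select_lev n i : vitali_select n i -> (lev i < n)%N.
Proof.
elim: n => [//|n ih] /= [/ih/ltnW//|].
by have [h _ _] := nextP (vitali_select n) n; move=> /h[_ ->].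
Qed.

Let select_triv n : trivIset (vitali_select n) B.
Proof.
elim: n => [//|n ih]; have [sub tri _] := nextP (vitali_select n) n.
move=> i j /= [Ui|Si] [Uj|Sj] ij.
- exact: ih.
- have [_ _ /(_ _ Ui)] := sub _ Sj; rewrite setIC => e.
  by move: ij; rewrite e => -[].
- have [_ _ /(_ _ Uj)] := sub _ Si => e.
  by move: ij; rewrite e => -[].
- exact: tri.
Qed.

(** A member that meets nothing selected at lower levels is a candidate at its own level, and
    maximality then forces it to meet something selected there. *)
Lemma vitali_selection : (forall i, D i -> B i !=set0) ->
  exists C : set I, [/\ C `<=` D, trivIset C B &
    forall i, D i -> exists j, [/\ C j, (lev j <= lev i)%N & B i `&` B j !=set0]].
Proof.
move=> B0; exists (\bigcup_n vitali_select n); split.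
- by move=> i [n _ /select_sub].
- move=> i j [m _ Um] [n _ Un]; apply: (select_triv (n := maxn m n)).
  + by apply: select_mono Um; rewrite leq_maxl.
  + by apply: select_mono Un; rewrite leq_maxr.
- move=> i Di; set U := vitali_select (lev i).
  have [[j [Uj ij]]|noU] := pselect (exists j, U j /\ B i `&` B j !=set0).
    by exists j; split => //; [exists (lev i)|rewrite ltnW// select_lev].
  have Ni : next U (lev i) i.
    split => // j Uj; apply/eqP/negPn/negP => /set0P ij; apply: noU; by exists j.
  have [sub tri max] := nextP U (lev i).
  set S := sval _ in sub tri max.
  have SC : S `<=` \bigcup_n vitali_select n.
    by move=> j Sj; exists (lev i).+1 => //=; right.
  have [[j [Sj ij]]|noS] := pselect (exists j, S j /\ B i `&` B j !=set0).
    by exists j; split => //; [exact: SC|have [_ ->] := sub _ Sj].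
  have nSi : ~ S i.
    by move=> Si; apply: noS; exists i; rewrite setIid; split => //; exact: B0.
  exfalso; apply: (max (S `|` [set i])).
  + by split; [exact: subsetUl|move=> h; apply: nSi; apply: h; right].
  + by move=> j [/sub//|->].
  + move=> j k [Sj|->] [Sk|->] // jk; first exact: tri.
    * by exfalso; apply: noS; exists j; split => //; rewrite setIC.
    * by exfalso; apply: noS; exists k.
Qed.

End vitali_selection.

Section countable_disjoint.
Context d (T : measurableType d) (R : realType) (mu : {measure set T -> \bar R}).
Context (I : choiceType) (B : I -> set T) (C : set I) (f : T -> \bar R).
Hypotheses (mB : forall i, measurable (B i)) (tB : trivIset C B).
Hypotheses (mf : measurable_fun setT f) (f0 : forall x, (0 <= f x)%E).
Local Open Scope ereal_scope.

(** At most [\int f / e] disjoint sets can each carry mass [e]. The centres of balls form a possibly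
    uncountable set, and this is how countability of the selected balls is obtained, one radius at a
    time. *)
Lemma finite_disjoint_large (e : R) : (0 < e)%R -> \int[mu]_x f x < +oo ->
  (forall i, C i -> e%:E <= \int[mu]_(x in B i) f x) -> finite_set C.
Proof.
move=> e0 fy ef; apply: contrapT => infC.
have fin : \int[mu]_x f x \is a fin_num by rewrite ge0_fin_numE// integral_ge0.
have [A [uA AC sA]] : exists A : seq I, [/\ uniq A, [set` A] `<=` C &
    (Num.truncn (fine (\int[mu]_x f x) / e) < size A)%N].
  have [A AC sA] :=
    infinite_set_fset (Num.truncn (fine (\int[mu]_x f x) / e)).+1 infC.
  by exists (finmap.enum_fset A); split => //; exact: finmap.fset_uniq.
have : \sum_(i <- A) \int[mu]_(x in B i) f x <= \int[mu]_x f x.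
  rewrite -ge0_integral_bigsetU//.
  - apply: ge0_subset_integral => //.
    by apply: bigsetU_measurable.
  - exact: sub_trivIset AC tB.
  - exact: measurable_funTS.
apply/negP; rewrite -ltNge.
apply: (@lt_le_trans _ _ (\sum_(i <- A) e%:E)); last first.
  rewrite big_seq [leRHS]big_seq; apply: lee_sum => i iA; exact/ef/AC.
rewrite sumEFin big_const_seq count_predT iter_addr addr0 -(fineK fin) lte_fin.
rewrite -mulr_natr mulrC -ltr_pdivrMr//.
apply: (lt_le_trans (truncnS_gt _)); rewrite ler_nat; exact: sA.
Qed.

(* An injection of [C] into the naturals turns both sides into series. *)
Lemma countable_disjoint_measure_le (A : I -> set T) (E : set T) (K : R) :
  countable C -> (0 <= K)%R -> measurable E -> (forall i, measurable (A i)) ->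
  E `<=` \bigcup_(i in C) A i ->
  (forall i, C i -> mu (A i) <= K%:E * \int[mu]_(x in B i) f x) ->
  mu E <= K%:E * \int[mu]_x f x.
Proof.
move=> /countable_injP[h hinj] K0 mE mA EA AB.
pose sel (F : I -> set T) n := \bigcup_(i in [set i | C i /\ h i = n]) F i.
have selE F i : C i -> sel F (h i) = F i.
  move=> Ci; apply/seteqP; split => [x [j [Cj hj] Fx]|x Fx]; last by exists i.
  by rewrite (_ : i = j)//; apply: hinj; rewrite ?inE.
have sel0 F n : ~ (exists2 i, C i & h i = n) -> sel F n = set0.
  by move=> no; apply/seteqP; split => // x [i [Ci hi] _]; apply: no; exists i.
have msel F n : (forall i, measurable (F i)) -> measurable (sel F n).
  move=> mF; have [[i Ci <-]|/sel0 ->//] := pselect (exists2 i, C i & h i = n).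
  by rewrite selE.
suff /le_trans : mu E <= \sum_(0 <= n <oo) mu (sel A n).
  apply.
  apply: (@le_trans _ _ (\sum_(0 <= n <oo) K%:E * \int[mu]_(x in sel B n) f x)).
    apply: lee_nneseries => // n _.
    have [[i Ci <-]|no] := pselect (exists2 i, C i & h i = n).
      by rewrite !selE//; exact: AB.
    by rewrite !sel0// measure0 mule_ge0// integral_ge0.
  rewrite nneseriesZl; last by move=> n _; exact: integral_ge0.
  rewrite lee_wpmul2l// -ge0_integral_bigcup//.
  - apply: ge0_subset_integral => //.
    by apply: bigcupT_measurable => n; exact: msel.
  - by move=> n; exact: msel.
  - exact: measurable_funTS.
  - move=> m n _ _ [x [[i [Ci <-] Bi] [j [Cj <-] Bj]]].
    by rewrite (tB Ci Cj)//; exists x.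
apply: measure_sigma_subadditive => //; first by move=> n; exact: msel.
by move=> x /EA[i Ci Ax]; exists (h i) => //; exists i.
Qed.

End countable_disjoint.

(** * Ahlfors regular spaces *)

Record ahlfors_space (R : realType) (disp : measure_display)
    (X : measurableType disp) (dist : X -> X -> R)
    (mu : {measure set X -> \bar R}) (Q A0 C1 C2 : R) : Prop := AhlforsSpace {
  dist_ge0 : forall x y, 0 <= dist x y;
  dist_eq0 : forall x y, dist x y = 0 <-> x = y;
  distC : forall x y, dist x y = dist y x;
  quasi_ge1 : 1 <= A0;
  dist_quasi : forall x y z, dist x y <= A0 * (dist x z + dist y z);
  sigma_qball : disp.-measurable = quasi_metric_sigma_algebra dist;
  dim_gt0 : 0 < Q;
  lower_gt0 : 0 < C1;
  upper_gt0 : 0 < C2;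
  mu_qball_ge : forall (x : X) (r : R), 0 < r ->
    ((C1 * r `^ Q)%:E <= mu (qball dist x r))%E;
  mu_qball_le : forall (x : X) (r : R), 0 < r ->
    (mu (qball dist x r) <= (C2 * r `^ Q)%:E)%E }.

Lemma ahlfors_regular_space (R : realType) (disp : measure_display)
    (X : measurableType disp) (dist : X -> X -> R)
    (mu : {measure set X -> \bar R}) (Q : R) : ahlfors_regular dist mu Q ->
  exists A0 C1 C2, ahlfors_space dist mu Q A0 C1 C2.
Proof.
move=> [[d0 dE dC [A0 A1 dT]] sX Q0 [C1 [C2 [C10 C20 h]]]].
exists A0, C1, C2; split => // x r /(h x)/andP[]//.
Qed.

Section space.
Context (R : realType) (disp : measure_display) (X : measurableType disp).
Context (dist : X -> X -> R) (mu : {measure set X -> \bar R}) (Q A0 C1 C2 : R).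
Hypothesis H : ahlfors_space dist mu Q A0 C1 C2.
Local Notation ball := (qball dist).

Lemma distxx x : dist x x = 0. Proof. by apply/(dist_eq0 H). Qed.

Lemma measurable_qball x r : measurable (ball x r).
Proof.
have [r0|r0] := ltP 0 r.
  have -> : disp.-measurable (ball x r) = quasi_metric_sigma_algebra dist (ball x r).
    by rewrite -(sigma_qball H).
  by apply: sub_sigma_algebra; left; exists x, r.
rewrite (_ : ball x r = set0)//; apply/seteqP; split => // y /=.
by rewrite /qball/= => /lt_le_trans/(_ r0); rewrite ltNge (dist_ge0 H).
Qed.

Lemma measurable_qopen U : qopen dist U -> measurable U.
Proof.
move=> oU.
have -> : disp.-measurable U = quasi_metric_sigma_algebra dist U.
  by rewrite -(sigma_qball H).
by apply: sub_sigma_algebra; right.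
Qed.

Lemma measurable_dist x : measurable_fun setT (dist x).
Proof.
move=> mD; apply: (measurability _ (RGenInftyO.measurableE R)) => //.
move=> _ [_ [a ->] <-]; rewrite setTI (_ : _ @^-1` _ = ball x a).
  exact: measurable_qball.
by apply/seteqP; split => y; rewrite /qball/= in_itv.
Qed.

Definition qinterior (A : set X) : set X :=
  [set z | exists2 e : R, 0 < e & ball z e `<=` A].

Lemma qinterior_sub A : qinterior A `<=` A.
Proof. by move=> z [e e0]; apply; rewrite /qball/= distxx. Qed.

Lemma qinterior_center x r : 0 < r -> qinterior (ball x r) x.
Proof. by move=> r0; exists r. Qed.

Lemma qopen_qinterior A : qopen dist (qinterior A).
Proof.
have A1 := quasi_ge1 H.
have A00 : 0 < A0 by lra.
(* With both steps shorter than [e / (2 * A0)], the quasi-triangle inequality keeps [v] within [e]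
   of [z]. *)
move=> z [e e0 zA]; exists (e / (2 * A0)); first by rewrite divr_gt0// mulr_gt0.
move=> w; rewrite /qball/= => zw; exists (e / (2 * A0)).
  by rewrite divr_gt0// mulr_gt0.
move=> v; rewrite /qball/= => wv; apply: zA; rewrite /qball/=.
apply: (le_lt_trans (dist_quasi H z v w)); rewrite (distC H v w) mulrC -ltr_pdivlMr//.
by rewrite (_ : e / A0 = e / (2 * A0) + e / (2 * A0)) ?ltrD//; field; rewrite gt_eqF.
Qed.

Lemma qopen_bigcup (I : Type) (D : set I) (U : I -> set X) :
  (forall i, D i -> qopen dist (U i)) -> qopen dist (\bigcup_(i in D) U i).
Proof.
move=> oU x [i Di Ux]; have [r r0 rU] := oU i Di x Ux.
by exists r => // y /rU; exists i.
Qed.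

Lemma mu_qball_fin x r : (mu (ball x r) < +oo)%E.
Proof.
apply: (@le_lt_trans _ _ (mu (ball x (Num.max r 1)))); last first.
  by apply: (le_lt_trans (mu_qball_le H x _)); rewrite ?ltry// lt_max ltr01 orbT.
apply: le_measure; rewrite ?inE; [exact: measurable_qball..|].
by move=> y; rewrite /qball/= lt_max => ->.
Qed.

Lemma measurable_qset1 (x : X) : measurable [set x].
Proof.
rewrite (_ : [set x] = \bigcap_n ball x (n.+1%:R^-1)).
  by apply: bigcapT_measurable => n; exact: measurable_qball.
apply/seteqP; split => [y -> n _|y h]; first by rewrite /qball/= distxx.
apply/esym/(dist_eq0 H)/eqP; rewrite eq_le (dist_ge0 H) andbT leNgt.
apply/negP => /[dup] xy /ltr_add_invr[n]; rewrite add0r => nxy.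
by have := lt_trans (h n I) nxy; rewrite ltxx.
Qed.

Lemma mu_set1 x : mu [set x] = 0%E.
Proof.
have m1 := measurable_qset1 x.
apply/eqP; rewrite eq_le measure_ge0 andbT; apply/lee_addgt0Pr => e e0.
have C20 := upper_gt0 H; have Q0 := dim_gt0 H.
rewrite add0e.
(* At this radius the upper bound [C2 * r ^ Q] equals [e]. *)
have r0 : 0 < (e / C2) `^ Q^-1 by rewrite powR_gt0// divr_gt0.
apply: (@le_trans _ _ (mu (ball x ((e / C2) `^ Q^-1)))).
  apply: le_measure; rewrite ?inE//; first exact: measurable_qball.
  by move=> y ->; rewrite /qball/= distxx.
apply: (le_trans (mu_qball_le H x r0)).
rewrite -powRrM mulVf ?gt_eqF// powRr1 ?divr_ge0 ?(ltW e0) ?(ltW C20)//.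
have -> : C2 * (e / C2) = e by field; rewrite gt_eqF.
by [].
Qed.

(** A bounded space would have finite measure, against the lower bound at large radii. Far points
    are needed to place [pinf] between the bounds of [p]. *)
Lemma dist_unbounded x (M : R) : exists y, M <= dist x y.
Proof.
apply: contrapT => no.
have M0 : 0 < Num.max M 1 by rewrite lt_max ltr01 orbT.
have {}no y : ball x (Num.max M 1) y.
  rewrite /qball/= lt_max; apply/orP; left; rewrite ltNge; apply/negP => h.
  by apply: no; exists y.
have C10 := lower_gt0 H; have C20 := upper_gt0 H; have Q0 := dim_gt0 H.
pose v := C2 / C1 * (Num.max M 1) `^ Q + 1.
have v0 : 0 < v by rewrite addr_gt0// mulr_gt0 ?divr_gt0 ?powR_gt0.
have r0 : 0 < v `^ Q^-1 by exact: powR_gt0.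
have sub : (mu (ball x (v `^ Q^-1)%R) <= mu (ball x (Num.max M 1)%R))%E.
  by apply: le_measure; rewrite ?inE; [exact: measurable_qball..|].
have := le_trans (mu_qball_ge H x r0) (le_trans sub (mu_qball_le H x M0)).
rewrite lee_fin -powRrM mulVf ?gt_eqF// powRr1 ?(ltW v0)// /v mulrDr mulr1.
rewrite mulrA [C1 * _]mulrC divfK ?gt_eqF//; lra.
Qed.

End space.

(** * The maximal function *)

Lemma level_eq (N k : int) (n : nat) : (k <= N)%R -> absz (N - k) = n ->
  k = (N - n%:Z)%R.
Proof. lia. Qed.

Lemma level_le (N k l : int) : (k <= N)%R -> (l <= N)%R ->
  (absz (N - l)%R <= absz (N - k)%R)%N -> (k <= l)%R.
Proof. lia. Qed.

Section maximal_function.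
Context (R : realType) (disp : measure_display) (X : measurableType disp).
Context (dist : X -> X -> R) (mu : {measure set X -> \bar R}) (Q A0 C1 C2 : R).
Hypothesis H : ahlfors_space dist mu Q A0 C1 C2.
Local Notation ball := (qball dist).

(* By Ahlfors regularity [r ^ Q] may replace the measure of the ball. *)
Definition avg (k : int) (x : X) (f : X -> \bar R) : \bar R :=
  ((dyadr k `^ (- Q))%:E * \int[mu]_(y in ball x (dyadr k)) f y)%E.

(* Interiors of balls are used because balls themselves need not be open, so
   that this noncentered maximal function is lower semicontinuous, hence
   measurable. *)
Definition maxfun (f : X -> \bar R) (y : X) : \bar R :=
  ereal_sup [set a | exists k x,
    qinterior dist (ball x (dyadr k)) y /\ a = avg k x f].

Section ge0.
Variables (f g : X -> \bar R).
Hypotheses (mf : measurable_fun setT f) (mg : measurable_fun setT g).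
Hypotheses (f0 : forall x, (0 <= f x)%E) (g0 : forall x, (0 <= g x)%E).
Local Open Scope ereal_scope.

Lemma avg_ge0 k x : 0 <= avg k x f.
Proof. by rewrite mule_ge0 ?integral_ge0// lee_fin powR_ge0. Qed.

Lemma avg_le_maxfun k x : avg k x f <= maxfun f x.
Proof.
apply: ereal_sup_ubound; exists k, x; split => //.
by apply: qinterior_center; exact: dyadr_gt0.
Qed.

Lemma maxfun_ge0 x : 0 <= maxfun f x.
Proof. by apply: le_trans (avg_le_maxfun 0 x); exact: avg_ge0. Qed.

(** A constant [a] averages to at most [C2 * a], not [a], because the normalisation is by [r ^ Q].
    Monotonicity, truncation and Jensen's inequality are all drawn from this affine form. *)
Lemma avg_le_affine k x (a b : R) : (0 <= a)%R -> (0 <= b)%R ->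
  (forall y, ball x (dyadr k) y -> f y <= a%:E + b%:E * g y) ->
  avg k x f <= (C2 * a)%:E + b%:E * avg k x g.
Proof.
move=> a0 b0 fg; have mB := measurable_qball H x (dyadr k).
apply: (@le_trans _ _ ((dyadr k `^ (- Q))%:E *
    (\int[mu]_(y in ball x (dyadr k)) (a%:E + b%:E * g y)))).
  rewrite lee_wpmul2l ?lee_fin ?powR_ge0//; apply: ge0_le_integral => //.
  - exact: measurable_funTS.
  - apply: measurable_funTS; apply: emeasurable_funD => //.
    exact: measurable_funeM.
rewrite ge0_integralD//; last 2 first.
- by move=> y _; rewrite mule_ge0.
- by apply: measurable_funTS; exact: measurable_funeM.
rewrite ge0_muleDr; last 2 first.
- by apply: integral_ge0 => y _; rewrite lee_fin.
- by apply: integral_ge0 => y _; rewrite mule_ge0.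
apply: leeD.
  rewrite integral_cst//.
  apply: (@le_trans _ _ ((dyadr k `^ (- Q))%:E * (a%:E * (C2 * dyadr k `^ Q)%R%:E))).
    rewrite lee_wpmul2l ?lee_fin ?powR_ge0//.
    by rewrite lee_wpmul2l ?lee_fin ?(mu_qball_le H)// dyadr_gt0.
  rewrite -!EFinM lee_fin powRN.
  have r0 : (dyadr k `^ Q != 0 :> R)%R by rewrite gt_eqF// powR_gt0// dyadr_gt0.
  by rewrite [leLHS](_ : _ = (C2 * a)%R)//; field.
rewrite ge0_integralZl//; first by rewrite /avg muleCA.
exact: measurable_funTS.
Qed.

Lemma le_avg k x : (forall y, ball x (dyadr k) y -> f y <= g y) ->
  avg k x f <= avg k x g.
Proof.
move=> fg; have := @avg_le_affine k x 0 1 (lexx _) ler01.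
rewrite mulr0 add0e mul1e; apply => y /fg; by rewrite add0e mul1e.
Qed.

Lemma avg_le_integral k x : avg k x f <= (dyadr k `^ (- Q))%:E * \int[mu]_y f y.
Proof.
rewrite lee_wpmul2l ?lee_fin ?powR_ge0// ge0_subset_integral//.
exact: measurable_qball H _ _.
Qed.

Lemma maxfun_gtP (t : \bar R) y : t < maxfun f y <->
  exists k x, qinterior dist (ball x (dyadr k)) y /\ t < avg k x f.
Proof.
split=> [/ereal_sup_gt[_ [k [x [h ->]]]] ?|[k [x [h ta]]]]; first by exists k, x.
by apply: (lt_le_trans ta); apply: ereal_sup_ubound; exists k, x.
Qed.

Lemma measurable_maxfun : measurable_fun setT (maxfun f).
Proof.
move=> mD; apply: (measurability _ (ErealGenOInfty.measurableE R)) => //.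
move=> _ [_ [a ->] <-]; rewrite setTI preimage_itvoy; apply: measurable_qopen.
  exact: H.
rewrite (_ : [set _ | _] = \bigcup_(i in [set i : X * int | a%:E < avg i.2 i.1 f])
    qinterior dist (ball i.1 (dyadr i.2))); last first.
  apply/seteqP; split => [y /maxfun_gtP[k [x [h ta]]]|y [[x k] /= h1 h2]].
    by exists (x, k).
  by apply/maxfun_gtP; exists k, x.
by apply: qopen_bigcup => i _; exact: qopen_qinterior H _.
Qed.

(** Vitali covering: among the balls whose average exceeds [t], a disjoint subfamily is selected
    whose enlargements cover the level set, and each selected ball carries at least [t * r ^ Q] of
    the integral of [f]. *)
Lemma maxfun_weak_type (t : R) : (0 < t)%R ->
  mu [set y | t%:E < maxfun f y] <=
  (C2 * (3 * A0 ^+ 2) `^ Q / t)%R%:E * \int[mu]_y f y.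
Proof.
move=> t0; set K := (C2 * _)%R.
have A1 := quasi_ge1 H; have C20 := upper_gt0 H; have Q0 := dim_gt0 H.
have A2 : (0 < 3 * A0 ^+ 2)%R by nra.
have K0 : (0 < K)%R by rewrite mulr_gt0// powR_gt0.
have [foo|] := eqVneq (\int[mu]_y f y) +oo.
  by rewrite foo gt0_muley ?leey// lte_fin divr_gt0.
rewrite -ltey => fy.
have : \int[mu]_y f y \is a fin_num by rewrite ge0_fin_numE// integral_ge0.
move=> /fineK; set m := fine _ => fm.
have m0 : (0 <= m)%R by rewrite fine_ge0// integral_ge0.
pose D := [set i : X * int | t%:E < avg i.2 i.1 f].
pose B (i : X * int) := ball i.1 (dyadr i.2).
have intB i : D i -> (t * dyadr i.2 `^ Q)%:E <= \int[mu]_(y in B i) f y.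
  rewrite /D/= /avg powRN => h.
  have r0 : (0 < dyadr i.2 `^ Q :> R)%R by rewrite powR_gt0// dyadr_gt0.
  by rewrite EFinM -lee_pdivlMr// muleC ltW.
(* An average above [t] makes [t * r ^ Q] at most the total integral [m], so the radii are bounded;
   the selection needs a largest scale to start from. *)
have [N DN] : exists N : int, forall i, D i -> (i.2 <= N)%R.
  have w0 : (0 < (m / t + 1) `^ Q^-1)%R.
    by rewrite powR_gt0// ltr_wpDl// divr_ge0// ltW.
  have [N /andP[_ wN]] := dyadr_itv w0; exists (N + 1)%R => i Di.
  rewrite leNgt; apply/negP => /ltW/le_dyadr/(lt_le_trans wN) => wi.
  have : (t * dyadr i.2 `^ Q)%:E <= m%:E.
    rewrite fm; apply: (le_trans (intB _ Di)); apply: ge0_subset_integral => //.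
    exact: measurable_qball H _ _.
  have : (m / t + 1 < dyadr i.2 `^ Q)%R.
    have := gt0_ltr_powR Q0; move=> /(_ _ _ _ _ wi).
    rewrite !nnegrE !ltW ?dyadr_gt0//= -powRrM mulVf ?gt_eqF// powRr1; last first.
      by rewrite addr_ge0// divr_ge0// ltW.
    by apply.
  by rewrite lee_fin -ler_pdivlMl// [(t^-1 * m)%R]mulrC; lra.
(* Counted down from the largest scale, so that a lower level means a larger radius. *)
pose lev (i : X * int) := absz (N - i.2)%R.
have B0 i : D i -> B i !=set0.
  by move=> _; exists i.1; rewrite /B /qball/= (distxx H) dyadr_gt0.
have [C [CD tC CV]] := vitali_selection lev B0.
have mB i : measurable (B i) by exact: measurable_qball H _ _.
(* Balls of one level share one radius, hence one lower bound for the integral of [f] over them, so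
   each level holds finitely many selected balls. *)
have cC : countable C.
  rewrite (_ : C = \bigcup_n (C `&` [set i | lev i = n])); last first.
    rewrite -setI_bigcupr; apply/seteqP; split => [i Ci|i []//].
    by split => //; exists (lev i).
  apply: bigcup_countable => // n _; apply: finite_set_countable.
  have tn : trivIset (C `&` [set i | lev i = n]) B.
    by apply: sub_trivIset tC; exact: subIsetl.
  have e0 : (0 < t * dyadr (N - n%:Z)%R `^ Q)%R by rewrite mulr_gt0// powR_gt0// dyadr_gt0.
  apply: (finite_disjoint_large mB tn mf f0 e0 fy) => i [/CD Di lin].
  have <- : i.2 = (N - n%:Z)%R by exact: level_eq (DN _ Di) lin.
  exact: intB.
have mE : measurable [set y | t%:E < maxfun f y].
  rewrite -[X in measurable X]setTI; apply: emeasurable_fun_o_infty => //.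
  exact: measurable_maxfun.
pose A (i : X * int) := ball i.1 (3 * A0 ^+ 2 * dyadr i.2)%R.
apply: (@countable_disjoint_measure_le _ _ _ _ _ B C f mB tC mf f0 A) => //.
- by rewrite ltW// divr_gt0.
- by move=> i; exact: measurable_qball H _ _.
- move=> y /maxfun_gtP[k [x [/(qinterior_sub H) xy tx]]].
  have Di : D (x, k) by [].
  have [[z l] [Cj jlev [v [xv zv]]]] := CV _ Di.
  exists (z, l) => //; rewrite /A /qball/=.
  have kl : (k <= l)%R.
    exact: level_le (DN _ Di) (DN _ (CD _ Cj)) jlev.
  have := le_dyadr (R := R) kl.
  rewrite /B /qball/= in xv zv xy.
  (* Going from [z] to [v], then from [v] through [x] to [y], gives less than
     [A0 * r + 2 * A0 ^ 2 * r] with [r = dyadr l]; this is the origin of the factor [3 * A0 ^ 2]. *)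
  have := dist_quasi H y v x; have := dist_quasi H z y v.
  rewrite (distC H y x) (distC H v x).
  have -> : (3 * A0 ^+ 2 * dyadr l = A0 * (A0 * (dyadr l + dyadr l) + A0 * dyadr l))%R by ring.
  move=> h1 h2 h3; apply: (le_lt_trans h1); rewrite ltr_pM2l; last by lra.
  have h4 : (A0 * (dist x y + dist x v) < A0 * (dyadr l + dyadr l))%R.
    by rewrite ltr_pM2l; lra.
  have h5 : (dyadr l <= A0 * dyadr l)%R by rewrite ler_peMl// ltW// dyadr_gt0.
  lra.
- move=> i /CD Di; apply: (le_trans (mu_qball_le H _ _)).
    by rewrite mulr_gt0// dyadr_gt0.
  apply: le_trans (lee_wpmul2l _ (intB _ Di)); last by rewrite lee_fin ltW// divr_gt0.
  rewrite -EFinM lee_fin powRM ?(ltW A2) ?(ltW (dyadr_gt0 _))//.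
  rewrite [leRHS](_ : _ = C2 * ((3 * A0 ^+ 2) `^ Q * dyadr i.2 `^ Q))%R//.
  by rewrite /K; field; rewrite gt_eqF.
Qed.

End ge0.
End maximal_function.

(* A discrete layer cake formula: the term with [dyadr k < v <= 4 * dyadr k]
   already dominates [v `^ s]. *)
Lemma poweR_le_zsum (R : realType) (s : R) (v : \bar R) : 1 <= s -> (0 <= v)%E ->
  (v `^ s <= zsum (fun k =>
    (4 `^ s * dyadr k `^ s)%:E * (if (dyadr k)%:E < v then 1 else 0)))%E.
Proof.
move=> s1 v0; set a := fun k : int => _.
have a0 k : (0 <= a k)%E.
  by rewrite /a mule_ge0 ?lee_fin ?mulr_ge0 ?powR_ge0//; case: ifP.
have key (w : R) : 0 < w -> exists k, dyadr k < w /\ w `^ s <= 4 `^ s * dyadr k `^ s.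
  move=> w0; have [k /andP[kw wk]] := dyadr_itv w0.
  have e : dyadr k = 2 * dyadr (k - 1) :> R by rewrite -dyadrS subrK.
  have p := dyadr_gt0 (R := R) (k - 1).
  (* Lowered by one: [dyadr k] may equal [w], and the series asks for a strict inequality. *)
  exists (k - 1); split; first by rewrite e in kw; lra.
  rewrite -powRM ?(ltW p)//; apply: le_powR2r; [lra|exact: ltW|].
  by move: wk; rewrite dyadrS e; lra.
case: v v0 @a a0 => [v| |//] v0 a a0.
- have [->|vn0] := eqVneq v 0.
    by rewrite poweR_EFin powR0 ?gt_eqF//; [exact: zsum_ge0|lra].
  have v00 : 0 < v by rewrite lt_neqAle eq_sym vn0.
  have [k [kv vk]] := key _ v00.
  apply: le_trans (zsum_ge_term a0 k).
  by rewrite /a lte_fin kv mule1 poweR_EFin lee_fin.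
- rewrite poweRyr ?gt_eqF//; last by lra.
  rewrite leye_eq; apply/eqP; apply/eqyP => A A0.
  have A1 : 0 < Num.max A 1 by rewrite lt_max ltr01 orbT.
  have [k [kv vk]] := key _ A1.
  apply: le_trans (zsum_ge_term a0 k).
  rewrite /a ltry mule1 lee_fin; apply: le_trans vk.
  apply: (@le_trans _ _ (Num.max A 1)); first by rewrite le_max lexx.
  by rewrite le1r_powR// le_max lexx orbT.
Qed.

(** * Strong type of the maximal function *)

Section strong_type.
Context (R : realType) (disp : measure_display) (X : measurableType disp).
Context (dist : X -> X -> R) (mu : {measure set X -> \bar R}) (Q A0 C1 C2 : R).
Hypothesis H : ahlfors_space dist mu Q A0 C1 C2.
Local Notation ball := (qball dist).
Local Notation avg := (avg dist mu Q).
Local Notation maxfun := (maxfun dist mu Q).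

(** Marcinkiewicz interpolation between the weak type bound and the trivial bound for bounded
    functions, with the layer cake integral replaced by a sum over powers of two. *)
Lemma maxfun_strong_type (s : R) : 1 < s -> exists2 K : R, 0 < K &
  forall f : X -> R, measurable_fun setT f -> (forall x, 0 <= f x) ->
  (\int[mu]_x (maxfun (EFin \o f) x `^ s) <= K%:E * \int[mu]_x (f x `^ s)%:E)%E.
Proof.
move=> s1; have s0 : 0 < s by lra.
have A1 := quasi_ge1 H; have C20 := upper_gt0 H; have Q0 := dim_gt0 H.
have A2 : 0 < 3 * A0 ^+ 2 by nra.
set W := C2 * (3 * A0 ^+ 2) `^ Q; have W0 : 0 < W by rewrite mulr_gt0// powR_gt0.
have b0 : 0 < s - 1 by lra.
set c := (2 `^ (s - 1) - 1)^-1.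
have c0 : 0 < c by rewrite invr_gt0 subr_gt0 powR2_gt1.
pose K := (4 `^ s * (2 * W)) * (c * (2 * (2 * C2)) `^ (s - 1)).
have p4 : 0 < 4 `^ s :> R by rewrite powR_gt0.
have A00 : 0 < A0 by lra.
exists K; first by rewrite /K !(mulr_gt0, powR_gt0).
move=> f mf f0.
have mEf : measurable_fun setT (EFin \o f) by exact/measurable_EFinP.
have f0' x : (0 <= (EFin \o f) x)%E by rewrite lee_fin.
have mM := measurable_maxfun H (EFin \o f).
(* What [cut k] removes from [f] is at most [dyadr k / (2 * C2)], so its averages are at most
   [dyadr k / 2]; the weak type bound is then applied to [cut k] at height [dyadr k / 2]. *)
pose cut (k : int) y := (if dyadr k < 2 * C2 * f y then f y else 0)%:E.
have mcut k : measurable_fun setT (cut k).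
  apply/measurable_EFinP; apply: measurable_fun_ifT => //.
  by apply: measurable_fun_ltr => //; exact: measurable_funM.
have cut0 k x : (0 <= cut k x)%E by rewrite lee_fin; case: ifP.
have mS (g : X -> \bar R) t : measurable [set x | (t%:E < maxfun g x)%E].
  rewrite -[X in measurable X]setTI; apply: emeasurable_fun_o_infty => //.
  exact: (measurable_maxfun H).
have weak k : (mu [set x | (dyadr k)%:E < maxfun (EFin \o f) x]
    <= (2 * W / dyadr k)%:E * \int[mu]_y cut k y)%E.
  have r0 := dyadr_gt0 (R := R) k.
  have r20 : 0 < dyadr k / 2 :> R by lra.
  have -> : 2 * W / dyadr k = W / (dyadr k / 2) by field; rewrite gt_eqF.
  apply: le_trans (maxfun_weak_type H (mcut k) (cut0 k) r20).
  apply: le_measure; rewrite ?inE//.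
  move=> y /= /maxfun_gtP[j [x [xy kj]]]; apply/maxfun_gtP; exists j, x; split => //.
  have : (avg j x (EFin \o f) <= (C2 * (dyadr k / (2 * C2)))%:E + 1%:E * avg j x (cut k))%E.
    apply: (avg_le_affine H) => //; first by rewrite ltW// divr_gt0// mulr_gt0.
    move=> z _; rewrite mul1e -EFinD lee_fin; case: ifPn => [_|].
      by rewrite lerDr ltW// divr_gt0// mulr_gt0.
    by rewrite -leNgt addr0 ler_pdivlMr ?mulr_gt0// mulrC.
  have -> : C2 * (dyadr k / (2 * C2)) = dyadr k / 2 by field; rewrite gt_eqF.
  move/(lt_le_trans kj); rewrite mul1e.
  case: (avg j x (cut k)) => [v|_|//]; last exact: ltry.
  by rewrite -EFinD !lte_fin; lra.
apply: (@le_trans _ _ (\int[mu]_x zsum (fun k => (4 `^ s * dyadr k `^ s)%:E *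
    (if (dyadr k)%:E < maxfun (EFin \o f) x then 1 else 0)))%E).
  apply: ge0_le_integral_nonmeas => x; first exact: poweR_ge0.
  by apply: poweR_le_zsum; [exact: ltW|exact: maxfun_ge0].
have mI k : measurable_fun setT
    (fun x => if ((dyadr k)%:E < maxfun (EFin \o f) x)%E then 1 else 0 : \bar R)%E.
  apply: measurable_fun_ifT => //.
  exact: measurable_fun_lte.
rewrite integral_zsum; last 2 first.
- by move=> k; exact: measurable_funeM.
- move=> k x; rewrite mule_ge0 ?lee_fin ?mulr_ge0 ?powR_ge0//.
  by case: ifP.
apply: (@le_trans _ _ (zsum (fun k => \int[mu]_x
    ((4 `^ s * (2 * W) * dyadr k `^ (s - 1))%:E * cut k x)))%E).
  apply: le_zsum => k.
    apply: integral_ge0 => x _; rewrite mule_ge0 ?lee_fin ?mulr_ge0 ?powR_ge0//.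
    by case: ifP.
  have r0 := dyadr_gt0 (R := R) k.
  rewrite !ge0_integralZl//; last 3 first.
  - by rewrite lee_fin !mulr_ge0 ?powR_ge0// ltW.
  - by move=> x _; case: ifP.
  - by rewrite lee_fin mulr_ge0 ?powR_ge0.
  have -> : (\int[mu]_x (if ((dyadr k)%:E < maxfun (EFin \o f) x) then 1 else 0) =
      mu [set x | (dyadr k)%:E < maxfun (EFin \o f) x])%E.
    rewrite -[X in _ = mu X]setIT -integral_indic//.
      apply: eq_integral => x _; rewrite indicE; case: ifPn => xk.
        by rewrite mem_set.
      by rewrite memNset//; exact/negP.
  apply: (le_trans (lee_wpmul2l _ (weak k))); first by rewrite lee_fin mulr_ge0 ?powR_ge0.
  rewrite muleA -EFinM powRB; last by rewrite gt_eqF ?implybT.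
  rewrite powRr1 ?(ltW r0)// [X in (_ <= X%:E * _)%E](_ : _ =
    4 `^ s * dyadr k `^ s * (2 * W / dyadr k))//.
  by field; rewrite gt_eqF.
rewrite -integral_zsum; last 2 first.
- by move=> k; exact: measurable_funeM.
- by move=> k x; rewrite mule_ge0// lee_fin !mulr_ge0 ?powR_ge0// ltW.
rewrite -ge0_integralZl//; last 3 first.
- by apply/measurable_EFinP; exact: measurableT_comp (measurable_powR s) mf.
- by move=> x _; rewrite lee_fin powR_ge0.
- by rewrite lee_fin !mulr_ge0 ?powR_ge0// ltW.
apply: ge0_le_integral_nonmeas => x.
  by apply: zsum_ge0 => k; rewrite mule_ge0// lee_fin !mulr_ge0 ?powR_ge0// ltW.
(* At a fixed [x] the sum is geometric with ratio [2 ^ (s - 1)] and stops once [dyadr k] reaches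
   [2 * C2 * f x]; since [s > 1] it is at most a multiple of [f x ^ (s - 1)]. *)
pose up (k : int) := (if dyadr k < 2 * C2 * f x then dyadr k `^ (s - 1) else 0).
have up0 k : (0 <= (up k)%:E)%E by rewrite lee_fin /up; case: ifP; rewrite ?powR_ge0.
rewrite (_ : (fun k => _) = (fun k => (4 `^ s * (2 * W) * f x)%:E * (up k)%:E)%E); last first.
  apply/funext => k; rewrite /cut/= /up -!EFinM; congr EFin.
  by case: ifP => _; ring.
rewrite zsumZl//; last by rewrite !mulr_ge0 ?powR_ge0 ?(ltW W0) ?(ltW C20).
apply: (@le_trans _ _ ((4 `^ s * (2 * W) * f x)%:E *
   (c * (2 * (2 * C2 * f x)) `^ (s - 1))%:E)%E).
  apply: lee_wpmul2l.
    by rewrite lee_fin !mulr_ge0 ?powR_ge0 ?(ltW W0) ?(ltW C20).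
  by apply: geometric_sum_up => //; rewrite !mulr_ge0 ?(ltW C20).
rewrite -!EFinM lee_fin.
have -> : 2 * (2 * C2 * f x) = (2 * (2 * C2)) * f x by ring.
rewrite powRM//; last by rewrite !mulr_ge0 ?(ltW C20).
rewrite -(@mulr_powRB1 _ (f x) s)//.
rewrite [leRHS](_ : _ = 4 `^ s * (2 * W) * f x *
  (c * ((2 * (2 * C2)) `^ (s - 1) * f x `^ (s - 1))))// /K; ring.
Qed.

End strong_type.

(** * The Riesz potential as a sum over dyadic scales *)

(** Above [l], the factor [h ^ (1 - s)] is at most [l ^ (1 - s)]. With [l] tuned to the average of
    [h ^ s], this linear bound in [h ^ s] yields Jensen's inequality. *)
Lemma young_le (R : realType) (h l s : R) : 0 <= h -> 0 < l -> 1 <= s ->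
  h <= l + l `^ (1 - s) * h `^ s.
Proof.
move=> h0 l0 s1; have [hl|lh] := leP h l.
  by rewrite (le_trans hl)// lerDl mulr_ge0 ?powR_ge0.
have h00 : 0 < h by exact: lt_trans lh.
suff : h <= l `^ (1 - s) * h `^ s by lra.
have {1}-> : h = h `^ (1 - s) * h `^ s.
  rewrite -powRD ?subrK ?powRr1 ?(ltW h00)//.
  by apply/implyP => _; rewrite gt_eqF.
rewrite ler_pM2r ?powR_gt0// -(opprB s 1) le_powR2rN//; [lra|exact: ltW].
Qed.

Section riesz.
Context (R : realType) (disp : measure_display) (X : measurableType disp).
Context (dist : X -> X -> R) (mu : {measure set X -> \bar R}) (Q A0 C1 C2 : R).
Hypothesis H : ahlfors_space dist mu Q A0 C1 C2.
Local Notation ball := (qball dist).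
Local Notation avg := (avg dist mu Q).
Local Notation maxfun := (maxfun dist mu Q).

Definition riesz_sum (alpha : R) (f : X -> R) (x : X) : \bar R :=
  zsum (fun k => (dyadr k `^ alpha)%:E * avg k x (EFin \o f))%E.

Lemma integral_ball_if x r (g : X -> \bar R) :
  (\int[mu]_y (if (dist x y < r)%R then g y else 0) =
   \int[mu]_(y in ball x r) g y)%E.
Proof.
rewrite [RHS]integral_mkcond; apply: eq_integral => y _; rewrite patchE.
case: ifPn => h; first by rewrite mem_set.
by rewrite memNset//; exact/negP.
Qed.

Lemma measurable_ball_if x r (g : X -> \bar R) : measurable_fun setT g ->
  measurable_fun setT (fun y => if (dist x y < r)%R then g y else 0%E).
Proof.
move=> mg; apply: measurable_fun_ifT => //.
by apply: measurable_fun_ltr => //; exact: measurable_dist H x.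
Qed.

(* The diagonal [y = x], where the kernel is infinite, is a null set. *)
Lemma integral_le_riesz_sum (alpha : R) (f : X -> R) (N : set X) (x : X)
    (g : X -> \bar R) : alpha < Q ->
  measurable_fun setT f -> (forall y, 0 <= f y) ->
  measurable N -> mu N = 0%E -> (forall y, 0 <= g y)%E ->
  (forall y, ~ N y -> y <> x -> g y <= (f y / dist x y `^ (Q - alpha))%:E)%E ->
  (\int[mu]_y g y <= (2 `^ (Q - alpha))%:E * riesz_sum alpha f x)%E.
Proof.
move=> aQ mf f0 mN N0 g0 gf.
have x1 := measurable_qset1 H x.
pose Z := N `|` [set x].
have mZ : measurable Z by exact: measurableU.
have Z0 : mu Z = 0%E by rewrite measureU0// (mu_set1 H).
(* A point with [dyadr k <= dist x y < dyadr (k + 1)] is caught by the open ball of index [k + 1];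
   evaluating the kernel at that larger radius costs the factor [2 ^ (Q - alpha)]. *)
pose c k : R := 2 `^ (Q - alpha) * dyadr k `^ (alpha - Q).
have c0 k : 0 <= c k by rewrite mulr_ge0 ?powR_ge0.
pose t k y := ((c k)%:E * (if (dist x y < dyadr k)%R then (f y)%:E else 0))%E.
have mfi k : measurable_fun setT
    (fun y => if (dist x y < dyadr k)%R then (f y)%:E else 0%E).
  by apply: measurable_ball_if; exact/measurable_EFinP.
have fi0 k y : (0 <= (if (dist x y < dyadr k)%R then (f y)%:E else 0) :> \bar R)%E.
  by case: ifP => // _; rewrite lee_fin.
have mt k : measurable_fun setT (t k) by exact: measurable_funeM.
have t0 k y : (0 <= t k y)%E by rewrite mule_ge0// lee_fin.
have mI : measurable_fun setT (fun y => (+oo * (\1_Z y)%:E)%E : \bar R).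
  by apply: measurable_funeM; apply/measurable_EFinP; exact: measurable_indic.
have I0 y : (0 <= +oo * (\1_Z y)%:E :> \bar R)%E by rewrite mule_ge0.
(* The infinite multiple of the indicator majorizes [g] on the null set [Z], where nothing is known
   about it, and integrates to 0. *)
apply: (@le_trans _ _ (\int[mu]_y (zsum (fun k => t k y) + +oo * (\1_Z y)%:E))%E).
  apply: ge0_le_integral_nonmeas => // y.
  have [Zy|Zy] := pselect (Z y).
    rewrite indicE mem_set// mule1.
    by rewrite addey ?leey// -ltNye (lt_le_trans ltNy0)//; exact: zsum_ge0.
  rewrite indicE memNset// mule0 adde0.
  have yx : y <> x by move=> e; apply: Zy; right.
  have Ny : ~ N y by move=> e; apply: Zy; left.
  apply: (le_trans (gf y Ny yx)).
  have d0 : 0 < dist x y.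
    rewrite lt_neqAle (dist_ge0 H) andbT eq_sym; apply/eqP => /(dist_eq0 H) e.
    exact: yx.
  have [k /andP[kd dk]] := dyadr_itv d0.
  apply: le_trans (zsum_ge_term (fun j => t0 j y) (k + 1)).
  rewrite /t dk lee_fin mulrC ler_wpM2r// /c dyadrSX mulrA.
  rewrite -powRD ?pnatr_eq0 ?implybT//.
  have -> : Q - alpha + (alpha - Q) = 0 by ring.
  rewrite powRr0 mul1r -powRN -(opprB Q) le_powR2rN//; first by lra.
  exact: dyadr_gt0.
rewrite ge0_integralD//; last 2 first.
- by move=> y _; exact: zsum_ge0.
- exact: measurable_zsum.
have mI1 : measurable_fun setT (fun y => (\1_Z y)%:E : \bar R).
  by apply/measurable_EFinP; exact: measurable_indic.
have I01 y : [set: X] y -> (0 <= (\1_Z y)%:E :> \bar R)%E by rewrite lee_fin.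
rewrite ge0_integralZl//.
rewrite integral_indic// setIT Z0 mule0 adde0.
rewrite integral_zsum// -zsumZl ?powR_ge0//; last first.
  by move=> k; rewrite mule_ge0 ?avg_ge0 ?lee_fin ?powR_ge0// => y; rewrite lee_fin.
apply: le_zsum => k; first exact: integral_ge0.
rewrite /t ge0_integralZl//; last by rewrite lee_fin.
rewrite integral_ball_if /avg !muleA lee_wpmul2r ?integral_ge0//.
  by move=> y _; rewrite lee_fin.
rewrite -!EFinM lee_fin /c -mulrA -powRD//.
by apply/implyP => _; rewrite gt_eqF// dyadr_gt0.
Qed.

(** * Jensen's inequality for averages over balls *)

Section jensen.
Variables (f : X -> R) (s : R).
Hypotheses (mf : measurable_fun setT f) (f0 : forall y, 0 <= f y) (s1 : 1 <= s).

Let mfs : measurable_fun setT (EFin \o (fun y => f y `^ s)).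
Proof. by apply/measurable_EFinP; exact: measurableT_comp (measurable_powR s) mf. Qed.

(** Young's inequality at [l = m ^ (1 / s)]: the constant averages to [C2 * l], and the power term
    to at most [l ^ (1 - s) * m], which is again [l]. *)
Lemma avg_jensen k x m : 0 < m ->
  (avg k x (EFin \o (fun y => f y `^ s)%R) <= m%:E)%E ->
  (avg k x (EFin \o f) <= ((C2 + 1) * m `^ s^-1)%:E)%E.
Proof.
move=> m0 am; have l0 : 0 < m `^ s^-1 by exact: powR_gt0.
have b0 : 0 <= (m `^ s^-1) `^ (1 - s) by exact: powR_ge0.
have mEf : measurable_fun setT (EFin \o f) by exact/measurable_EFinP.
have fE0 y : (0 <= (EFin \o f) y)%E by rewrite lee_fin.
have fsE0 y : (0 <= (EFin \o (fun y => f y `^ s)%R) y)%E.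
  by rewrite lee_fin powR_ge0.
have pw y : ball x (dyadr k) y -> ((EFin \o f) y <= (m `^ s^-1)%:E +
    ((m `^ s^-1) `^ (1 - s))%:E * (EFin \o (fun y => f y `^ s)%R) y)%E.
  by move=> _; rewrite lee_fin; exact: young_le.
apply: (le_trans (avg_le_affine H mEf mfs fE0 fsE0 (ltW l0) b0 pw)).
have b0' : (0 <= ((m `^ s^-1) `^ (1 - s))%:E)%E by rewrite lee_fin.
apply: (le_trans (leeD (lexx _) (lee_wpmul2l b0' am))).
rewrite -EFinM -EFinD lee_fin mulrDl mul1r lerD2l -powRrM.
rewrite -[X in _ * X](powRr1 (ltW m0)) -powRD; last first.
  by apply/implyP => _; rewrite gt_eqF.
have s0 : s != 0 by rewrite gt_eqF// (lt_le_trans ltr01 s1).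
by rewrite (_ : s^-1 * (1 - s) + 1 = s^-1)//; field.
Qed.

Lemma avg_le_dyadr (M : R) k x : 0 < M ->
  (\int[mu]_y (f y `^ s)%:E <= M%:E)%E ->
  (avg k x (EFin \o f) <=
    ((C2 + 1) * M `^ s^-1 * dyadr k `^ (- (Q / s)))%:E)%E.
Proof.
move=> M0 fM; have r0 := dyadr_gt0 (R := R) k.
have m0 : 0 < M * dyadr k `^ (- Q) by rewrite mulr_gt0 ?powR_gt0.
have := @avg_jensen k x _ m0; rewrite powRM ?powR_ge0 ?(ltW M0)// -powRrM mulNr mulrA.
apply; apply: (le_trans (avg_le_integral H mfs _ _ _)).
  by move=> y; rewrite lee_fin powR_ge0.
by rewrite EFinM muleC lee_wpmul2r// lee_fin powR_ge0.
Qed.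

End jensen.

(** The sequence is abstract so that averages restricted to a range of scales can be inserted.
    Pulling the constant out of the minimum requires a factor at least 1, hence [B + 1]. *)
Lemma riesz_sum_le_split (alpha t t0 a B : R) (c : int -> \bar R) :
  0 < alpha -> alpha < t0 -> t0 <= t -> 0 < a -> 0 <= B ->
  (forall k, 0 <= c k)%E -> (forall k, c k <= a%:E)%E ->
  (forall k, c k <= (B * dyadr k `^ (- t))%:E)%E ->
  (zsum (fun k => (dyadr k `^ alpha)%:E * c k) <= ((B + 1) *
    (2 `^ alpha / (2 `^ alpha - 1) + (1 - 2 `^ (- (t0 - alpha)))^-1)
        * a `^ (1 - alpha / t))%:E)%E.
Proof.
move=> al0 alt0 t0t a0 B0 c0 ca cB.
apply: (@le_trans _ _ (zsum (fun k => (B + 1)%:E *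
    (dyadr k `^ alpha * Num.min a (dyadr k `^ (- t)))%:E))%E).
  apply: le_zsum => k; first by rewrite mule_ge0 ?lee_fin ?powR_ge0.
  rewrite -EFinM mulrCA EFinM lee_wpmul2l ?lee_fin ?powR_ge0//.
  have p := powR_gt0 (- t) (dyadr_gt0 (R := R) k).
  rewrite minEle; case: ifP => _.
    apply: (le_trans (ca k)); rewrite lee_fin ler_peMl//; [exact: ltW|lra].
  by apply: (le_trans (cB k)); rewrite lee_fin ler_pM2r//; lra.
rewrite zsumZl; last 2 first.
- move=> k; rewrite lee_fin mulr_ge0 ?powR_ge0// le_min (ltW a0)/=.
  exact: powR_ge0.
- lra.
rewrite -mulrA EFinM lee_wpmul2l ?lee_fin ?hedberg_sum//; lra.
Qed.

(** The exponent exceeds the dimension, which gives integrability, while the condition at infinity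
    bounds the powers [- |p x - pinf|] of this function. *)
Definition decay (x0 x : X) : R := (expR 1 + dist x x0) `^ (- (Q + 1)).

Lemma expR1D_gt1 x y : 1 < expR 1 + dist x y.
Proof.
have e1 : 1 < expR 1 :> R by rewrite expR_gt1.
by rewrite (lt_le_trans e1)// lerDl (dist_ge0 H).
Qed.

Lemma decay_gt0 x0 x : 0 < decay x0 x.
Proof. by rewrite powR_gt0// (lt_trans ltr01)// expR1D_gt1. Qed.

Lemma decay_le1 x0 x : decay x0 x <= 1.
Proof.
have Q0 := dim_gt0 H; rewrite -(powRr0 (expR 1 + dist x x0)).
by rewrite ler_powR ?(ltW (expR1D_gt1 _ _))// oppr_le0; lra.
Qed.

Lemma measurable_decay x0 : measurable_fun setT (decay x0).
Proof.
apply: (measurableT_comp (measurable_powR _)).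
apply: measurable_funD => //.
rewrite (_ : dist^~ x0 = dist x0); first exact: measurable_dist H x0.
by apply/funext => x; exact: distC H _ _.
Qed.

Lemma integral_decay x0 : exists2 M : R, 0 < M &
  (\int[mu]_x (decay x0 x)%:E <= M%:E)%E.
Proof.
have Q0 := dim_gt0 H; have C20 := upper_gt0 H.
pose c : R := 2 `^ (Q + 1); have c0 : 0 < c by rewrite powR_gt0.
pose g (k : int) : R := if 1 <= dyadr k :> R then dyadr k `^ (- (Q + 1)) else 0.
have g0 k : 0 <= g k by rewrite /g; case: ifP; rewrite ?powR_ge0.
pose t k x := ((c * g k)%:E * (if (dist x0 x < dyadr k)%R then 1 else 0))%E.
have mI k : measurable_fun setT
   (fun x => if (dist x0 x < dyadr k)%R then 1%E else 0%E : \bar R).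
  exact: measurable_ball_if.
have t0 k x : (0 <= t k x)%E.
  by rewrite mule_ge0 ?lee_fin ?mulr_ge0 ?(ltW c0)//; case: ifP.
have K0 : 0 < (1 - 2 `^ (- 1) : R)^-1.
  by rewrite invr_gt0 subr_gt0 powRN invf_lt1 ?powR2_gt1// powR_gt0.
exists ((c * C2) * ((1 - 2 `^ (- 1))^-1 * 1 `^ (- 1))).
  by rewrite powR1 mulr1 !mulr_gt0.
apply: (@le_trans _ _ (\int[mu]_x zsum (fun k => t k x))%E).
  apply: ge0_le_integral_nonmeas => x; first by rewrite lee_fin ltW// decay_gt0.
  (* The maximum with 1 leaves only radii above 1, where the measure of the ball times
     [r ^ (- (Q + 1))] is of order [1 / r] and sums geometrically. *)
  have v0 : 0 < Num.max 1 (dist x0 x) by rewrite lt_max ltr01.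
  have [k /andP[kv vk]] := dyadr_itv v0.
  apply: le_trans (zsum_ge_term (fun j => t0 j x) (k + 1)).
  move: vk; rewrite gt_max => /andP[k1 dk].
  rewrite /t dk mule1 lee_fin /g (ltW k1) /c dyadrSX mulrA -powRD; last first.
    by rewrite pnatr_eq0 implybT.
  rewrite subrr powRr0 mul1r /decay le_powR2rN//; [lra|exact: dyadr_gt0|].
  apply: (le_trans kv); rewrite ge_max (ltW (expR1D_gt1 _ _))/= (distC H x0).
  by rewrite lerDr expR_ge0.
rewrite integral_zsum//; last by move=> k; exact: measurable_funeM.
apply: (@le_trans _ _ (zsum (fun k => (c * C2)%:E *
    (if 1 <= dyadr k :> R then dyadr k `^ (- 1) else 0)%:E))%E).
  apply: le_zsum => k; first exact: integral_ge0.
  rewrite /t ge0_integralZl//; last 2 first.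
  - by move=> x _; case: ifP.
  - by rewrite lee_fin mulr_ge0 ?(ltW c0).
  rewrite integral_ball_if integral_cst; last exact: measurable_qball H _ _.
  rewrite mul1e.
  apply: (le_trans (lee_wpmul2l _ (mu_qball_le H _ (dyadr_gt0 _)))).
    by rewrite lee_fin mulr_ge0 ?(ltW c0).
  rewrite -!EFinM lee_fin /g; case: ifP => _; last by rewrite mulr0 mul0r mulr0.
  have r0 := dyadr_gt0 (R := R) k.
  rewrite [leLHS](_ : _ = c * C2 * (dyadr k `^ (- (Q + 1)) * dyadr k `^ Q)); last by ring.
  rewrite -powRD; last first.
    by apply/implyP => _; rewrite gt_eqF.
  by rewrite (_ : - (Q + 1) + Q = -1)//; ring.
rewrite zsumZl; last 2 first.
- by move=> k; rewrite lee_fin; case: ifP; rewrite ?powR_ge0.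
- by rewrite mulr_ge0// ltW.
rewrite [leRHS]EFinM lee_wpmul2l ?lee_fin ?geometric_sum_down//.
by rewrite mulr_ge0// ltW.
Qed.

End riesz.

(** * Variable exponents *)

(** Quantitative form of the hypotheses: the bounds [s] and [pp] hold at every point, and the local
    condition refers to the radius of a ball instead of a distance, as the averages require. *)
Record exponents (R : realType) (X : Type) (dist : X -> X -> R) (Q alpha : R)
    (x0 : X) (p q : X -> R) (s pp pinf c0 cinf : R) : Prop := Exponents {
  alpha_gt0 : 0 < alpha;
  s_gt1 : 1 < s;
  p_ge : forall x, s <= p x;
  p_le : forall x, p x <= pp;
  pp_lt : pp < Q / alpha;
  pinf_itv : s <= pinf <= pp;
  c0_ge0 : 0 <= c0;
  cinf_ge0 : 0 <= cinf;
  p_local : forall x y (r : R), 0 < r <= 2^-1 -> dist x y < r ->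
    (p x - p y) * - ln r <= c0;
  p_infty : forall x, `|p x - pinf| * ln (expR 1 + dist x x0) <= cinf;
  q_def : forall x, 1 / p x - 1 / q x = alpha / Q }.

Section pointwise.
Context (R : realType) (disp : measure_display) (X : measurableType disp).
Context (dist : X -> X -> R) (mu : {measure set X -> \bar R}) (Q A0 C1 C2 : R).
Context (alpha : R) (x0 : X) (p q : X -> R) (s pp pinf c0 cinf : R).
Hypothesis H : ahlfors_space dist mu Q A0 C1 C2.
Hypothesis E : exponents dist Q alpha x0 p q s pp pinf c0 cinf.
Local Notation ball := (qball dist).
Local Notation avg := (avg dist mu Q).
Local Notation decay := (decay dist Q x0).

(** The value of [q] that corresponds to the value [pp] of [p]; it bounds [q] from above. *)
Definition qmax : R := (pp^-1 - alpha / Q)^-1.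

Lemma p_gt1 x : 1 < p x.
Proof. exact: lt_le_trans (s_gt1 E) (p_ge E x). Qed.

Lemma pp_gt1 : 1 < pp. Proof. exact: lt_le_trans (p_gt1 x0) (p_le E x0). Qed.

Lemma q_inv x : (q x)^-1 = (p x)^-1 - alpha / Q.
Proof. by have := q_def E x; rewrite !div1r => <-; ring. Qed.

Lemma alphaQ t : 0 < t -> t <= pp -> alpha / Q < t^-1.
Proof.
move=> t0 tpp; have Q0 := dim_gt0 H; have a0 := alpha_gt0 E.
have := le_lt_trans tpp (pp_lt E); rewrite ltr_pdivlMr// => h.
by rewrite ltr_pdivrMr// mulrC ltr_pdivlMr// mulrC.
Qed.

Lemma qmax_gt0 : 0 < qmax.
Proof. by rewrite invr_gt0 subr_gt0 alphaQ// (lt_trans ltr01 pp_gt1). Qed.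

Lemma q_gt0 x : 0 < q x.
Proof.
rewrite -invr_gt0 q_inv subr_gt0 alphaQ ?(p_le E)//.
exact: lt_trans ltr01 (p_gt1 x).
Qed.

Lemma q_le_max x : q x <= qmax.
Proof.
rewrite /qmax -[q x]invrK lef_pV2 ?posrE ?invr_gt0 ?q_gt0//; last first.
  by rewrite subr_gt0 alphaQ// (lt_trans ltr01 pp_gt1).
rewrite q_inv lerD2r lef_pV2 ?posrE ?(p_le E)//.
  exact: lt_trans ltr01 pp_gt1.
exact: lt_trans ltr01 (p_gt1 x).
Qed.

Lemma powR_q_le K x : 1 <= K -> K `^ q x <= K `^ qmax.
Proof. by move=> K1; rewrite ler_powR// q_le_max. Qed.

(** The exponents differ by at most [px - P]. For [m <= 1] the change helps; for [m > 1] the surplus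
    is at most a power of [r ^ (- Q)] with exponent [px - P], up to [B], and the logarithmic
    condition bounds it by [expR (Q * c0)]. *)
Lemma local_power (B m r P px : R) : 0 < m -> 1 <= B -> 0 < r <= 2^-1 ->
  s <= P -> P <= px -> (px - P) * - ln r <= c0 -> m <= B * r `^ (- (Q / s)) ->
  m `^ (s / P) <= B * expR (Q * c0) * m `^ (s / px).
Proof.
move=> m0 B1 /andP[r0 r2] sP Ppx loc mB.
have s1 := s_gt1 E; have Q0 := dim_gt0 H; have c00 := c0_ge0 E.
have [P0 px0 s0] : [/\ 0 < P, 0 < px & 0 < s] by split; lra.
have r1 : r < 1.
  by apply: (le_lt_trans r2); rewrite invf_lt1 ?ltr1n.
have lr : 0 < - ln r by rewrite oppr_gt0 ln_lt0// r0.
pose de := s / P - s / px.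
have deE : de = s / P * ((px - P) / px) by rewrite /de; field; rewrite !gt_eqF.
have sP1 : s / P <= 1 by rewrite ler_pdivrMr// mul1r.
have sP0 : 0 < s / P by rewrite divr_gt0.
have dp0 : 0 <= (px - P) / px by rewrite divr_ge0 ?subr_ge0// ltW.
have dp1 : (px - P) / px <= px - P.
  by rewrite ler_pdivrMr// ler_peMr ?subr_ge0//; lra.
have dp2 : (px - P) / px <= 1 by rewrite ler_pdivrMr// mul1r; lra.
have de0 : 0 <= de by rewrite deE mulr_ge0// ltW.
have de1 : de <= 1 by rewrite deE mulr_ile1// ltW.
have de2 : de <= px - P.
  rewrite deE; apply: le_trans dp1; rewrite ler_piMl//.
have e1 : 1 <= expR (Q * c0) by rewrite -expR0 ler_expR mulr_ge0// ltW.
have K1 : 1 <= B * expR (Q * c0) by rewrite mulr_ege1.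
have [m1|m1] := leP m 1.
  apply: (@le_trans _ _ (m `^ (s / px))); last by rewrite ler_peMl// powR_ge0.
  by apply: ger_powR; [rewrite m0|rewrite -subr_ge0].
have -> : s / P = de + s / px by rewrite /de subrK.
rewrite powRD; last by apply/implyP => _; rewrite gt_eqF.
rewrite ler_pM2r ?powR_gt0//.
apply: (le_trans (le_powR2r de0 (ltW m0) mB)).
rewrite powRM ?powR_ge0//; last by lra.
apply: ler_pM; rewrite ?powR_ge0//.
  by rewrite ler1_powR.
rewrite -powRrM /powR gt_eqF// ler_expR.
have -> : - (Q / s) * de * ln r = Q * (de * - ln r / s) by ring.
rewrite ler_pM2l// ler_pdivrMr//.
have : de * - ln r <= c0 by apply: le_trans loc; rewrite ler_pM2r.
move=> h; apply: (le_trans h); rewrite ler_peMr//; lra.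
Qed.

(** One factor [C2 + 1] comes from Jensen's inequality, the remaining product from [local_power]
    with [B = C2 + 1]. *)
Definition loc_cst : R := (C2 + 1) * ((C2 + 1) * expR (Q * c0)).

Lemma loc_cst_ge1 : 1 <= loc_cst.
Proof.
have Q0 := dim_gt0 H; have c00 := c0_ge0 E; have C20 := upper_gt0 H.
have e1 : 1 <= expR (Q * c0) by rewrite -expR0 ler_expR mulr_ge0// ltW.
by rewrite !mulr_ege1//; lra.
Qed.

Hypothesis mp : measurable_fun setT p.

Lemma measurable_pow (f b : X -> R) : measurable_fun setT f ->
  measurable_fun setT b -> (forall x, 0 <= f x) -> (forall x, 0 < b x) ->
  measurable_fun setT (fun x => f x `^ b x).
Proof.
move=> mf mb f0 b0; rewrite (_ : (fun x => _) =
  (fun x => if f x == 0 then 0 else expR (b x * ln (f x)))); last first.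
  by apply/funext => x; rewrite /powR; case: ifP => // _; rewrite gt_eqF.
apply: measurable_fun_ifT => //; first exact: measurable_fun_eqr.
have mln : measurable_fun setT (fun x => ln (f x)).
  exact: measurableT_comp (@measurable_ln R) mf.
have mbl : measurable_fun setT (fun x => b x * ln (f x)) by exact: measurable_funM.
exact: measurableT_comp (@measurable_expR R) mbl.
Qed.

(* Near [x] the exponent is at least [P = max s (p x - osc)], so that [f] is
   dominated by a power of [f `^ (p / s)] and Jensen applies; by log-Hoelder
   continuity replacing [P] by [p x] costs only a constant factor. *)
Lemma avg_local (f : X -> R) (k : int) (x : X) (m : R) :
  measurable_fun setT f -> (forall y, f y = 0 \/ 1 <= f y) ->
  (\int[mu]_y (f y `^ p y)%:E <= 1)%E -> 0 < m -> k < 0 ->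
  (avg k x (EFin \o (fun y => f y `^ (p y / s))%R) <= m%:E)%E ->
  (avg k x (EFin \o f) <= (loc_cst * m `^ (s / p x))%:E)%E /\
  (avg k x (EFin \o f) <=
    (loc_cst * (C2 + 1) * dyadr k `^ (- (Q / p x)))%:E)%E.
Proof.
move=> mf f01 fp m0 k0 gm.
have s1 := s_gt1 E; have Q0 := dim_gt0 H; have c00 := c0_ge0 E.
have C20 := upper_gt0 H; have s0 : 0 < s by lra.
have f0 y : 0 <= f y by case: (f01 y) => [->//|]; lra.
have p0 y : 0 < p y by exact: lt_trans ltr01 (p_gt1 y).
have r0 := dyadr_gt0 (R := R) k.
have r2 : dyadr k <= 2^-1 :> R.
  rewrite (_ : 2^-1 = dyadr (-1)); last by rewrite /dyadr exprN1.
  by apply: le_dyadr; clear -k0; lia.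
have r12 : 0 < @dyadr R k <= 2^-1 by apply/andP; split.
have r1 : dyadr k < 1 :> R by rewrite (le_lt_trans r2)// invf_lt1 ?ltr1n.
have lr : 0 < - ln (dyadr k) :> R.
  by rewrite oppr_gt0 ln_lt0//; apply/andP; split.
pose g y := f y `^ (p y / s).
have ps0 y : 0 < p y / s by rewrite divr_gt0.
have mg : measurable_fun setT g.
  apply: measurable_pow => //; exact: measurable_funM.
have g0 y : 0 <= g y by exact: powR_ge0.
have gs y : g y `^ s = f y `^ p y by rewrite /g -powRrM divfK ?gt_eqF.
pose B := C2 + 1; have B1 : 1 <= B by rewrite /B; lra.
have gB : (avg k x (EFin \o g) <= (B * dyadr k `^ (- (Q / s)))%:E)%E.
  have := @avg_le_dyadr _ _ _ _ _ _ _ _ _ H g s mg g0 (ltW s1) 1 k x ltr01.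
  rewrite powR1 mulr1; apply; under eq_integral do rewrite gs; exact: fp.
(* Capping [m] by the decay bound supplies the control by a power of the radius that [local_power]
   demands, and yields the second conclusion from the same estimate. *)
pose m' := Num.min m (B * dyadr k `^ (- (Q / s))).
have m'0 : 0 < m' by rewrite lt_min m0 mulr_gt0 ?powR_gt0//; lra.
have gm' : (avg k x (EFin \o g) <= m'%:E)%E.
  by rewrite /m' minEle; case: ifP.
pose P := Num.max s (p x - c0 / - ln (dyadr k)).
have sP : s <= P by rewrite /P le_max lexx.
have P0 : 0 < P by lra.
have Ppx : P <= p x.
  by rewrite /P ge_max (p_ge E)/= lerBlDr lerDl divr_ge0// ltW.
have Py y : ball x (dyadr k) y -> P <= p y.
  rewrite /qball/= => xy; rewrite /P ge_max (p_ge E)/=.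
  have := p_local E r12 xy; rewrite -ler_pdivlMr// ; lra.
have Ploc : (p x - P) * - ln (dyadr k) <= c0.
  rewrite -ler_pdivlMr// /P lerBlDr -lerBlDl le_max; apply/orP; right; lra.
pose th := P / s; have th1 : 1 <= th by rewrite /th ler_pdivlMr// mul1r.
pose h y := g y `^ th^-1.
have mh : measurable_fun setT h by exact: measurableT_comp (measurable_powR _) mg.
have h0 y : 0 <= h y by exact: powR_ge0.
have hth y : h y `^ th = g y.
  by rewrite /h -powRrM mulVf ?powRr1// gt_eqF//; lra.
(* Here [h] is [f ^ (p / P)] with [p / P >= 1] on the ball, so this is where [f] must have no values
   strictly between 0 and 1. *)
have fh y : ball x (dyadr k) y -> f y <= h y.
  move=> xy; rewrite /h /g -powRrM.
  have -> : p y / s * th^-1 = p y / P by rewrite /th; field; rewrite !gt_eqF.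
  have [->|f1] := f01 y; first exact: powR_ge0.
  by rewrite le1r_powR// ler_pdivlMr// mul1r Py.
have key : (avg k x (EFin \o f) <= (loc_cst * m' `^ (s / p x))%:E)%E.
  apply: (@le_trans _ _ (avg k x (EFin \o h))).
    apply: (le_avg H).
    - exact/measurable_EFinP.
    - exact/measurable_EFinP.
    - by move=> y; rewrite lee_fin.
    - by move=> y; rewrite lee_fin.
    - by move=> y /fh; rewrite lee_fin.
  have := @avg_jensen _ _ _ _ _ _ _ _ _ H h th mh h0 th1 k x _ m'0.
  have -> : (fun y => h y `^ th) = g by apply/funext.
  move=> /(_ gm')/le_trans; apply; rewrite lee_fin /loc_cst -mulrA.
  rewrite ler_pM2l; last by lra.
  rewrite /th invf_div; apply: (local_power m'0 B1 r12) => //.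
  by rewrite /m' ge_min lexx orbT.
have sp0 : 0 <= s / p x by rewrite divr_ge0// ltW.
have L0 : 0 < loc_cst by exact: lt_le_trans ltr01 loc_cst_ge1.
split; apply: (le_trans key); rewrite lee_fin.
  by rewrite ler_pM2l// le_powR2r ?(ltW m'0)// /m' ge_min lexx.
rewrite -mulrA ler_pM2l//.
apply: (@le_trans _ _ ((B * dyadr k `^ (- (Q / s))) `^ (s / p x))).
  by rewrite le_powR2r ?(ltW m'0)// /m' ge_min lexx orbT.
rewrite powRM ?powR_ge0//; last by lra.
rewrite -powRrM.
have -> : - (Q / s) * (s / p x) = - (Q / p x) by field; rewrite !gt_eqF.
rewrite ler_pM2r ?powR_gt0// ler1_powR// ler_pdivrMr// mul1r.
exact: p_ge E x.
Qed.

End pointwise.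

Lemma le_powRD (R : realType) (a b r : R) : 0 <= a -> 0 <= b -> 0 <= r ->
  (a + b) `^ r <= 2 `^ r * (a `^ r + b `^ r).
Proof.
move=> a0 b0 r0; wlog ab : a b a0 b0 / a <= b => [h|].
  have [|ba] := leP a b; first exact: h.
  by rewrite addrC [a `^ r + _]addrC; apply: h => //; exact: ltW.
apply: (@le_trans _ _ ((2 * b) `^ r)); first by rewrite le_powR2r//; lra.
by rewrite powRM// ler_pM2l ?powR_gt0// lerDr powR_ge0.
Qed.

Lemma le_poweRD (R : realType) (a b : \bar R) (r : R) :
  (0 <= a -> 0 <= b -> (0 < r)%R ->
  (a + b) `^ r <= (2 `^ r)%R%:E * (a `^ r + b `^ r))%E.
Proof.
move=> a0 b0 r0; have y1 : ((2 `^ r)%R%:E * +oo = +oo :> \bar R)%E.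
  by rewrite gt0_muley// lte_fin powR_gt0.
have yr : (+oo `^ r = +oo :> \bar R)%E by rewrite poweRyr// gt_eqF.
case: a b a0 b0 => [a| |//] [b| |//] a0 b0; last 3 first.
- by rewrite yr poweR_EFin addey// y1 leey.
- by rewrite yr poweR_EFin addye// y1 leey.
- by rewrite yr addey// y1 leey.
by rewrite -EFinD !poweR_EFin -EFinD -EFinM lee_fin le_powRD// ltW.
Qed.

(** * Hedberg sums raised to a variable exponent *)

Section core.
Context (R : realType) (disp : measure_display) (X : measurableType disp).
Context (dist : X -> X -> R) (mu : {measure set X -> \bar R}) (Q A0 C1 C2 : R).
Context (alpha : R) (x0 : X) (p q : X -> R) (s pp pinf c0 cinf : R).
Hypothesis H : ahlfors_space dist mu Q A0 C1 C2.
Hypothesis E : exponents dist Q alpha x0 p q s pp pinf c0 cinf.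
Hypothesis mp : measurable_fun setT p.
Local Notation ball := (qball dist).
Local Notation avg := (avg dist mu Q).
Local Notation maxfun := (maxfun dist mu Q).
Local Notation udecay := (decay dist Q x0).
Local Notation qmax := (qmax Q alpha pp).

Lemma alpha_lt t : 0 < t -> t <= pp -> alpha < Q / t.
Proof.
move=> t0 tpp; have := alphaQ H E t0 tpp; have Q0 := dim_gt0 H.
by rewrite ltr_pdivrMr// mulrC.
Qed.

Lemma hedberg_cst_gt0 (t : R) : 0 < t -> t <= pp ->
  0 < 2 `^ alpha / (2 `^ alpha - 1) + (1 - 2 `^ (- (Q / t - alpha)))^-1.
Proof.
move=> t0 tpp; have a0 := alpha_gt0 E.
have d0 : 0 < Q / t - alpha by rewrite subr_gt0 alpha_lt.
rewrite addr_gt0// ?divr_gt0 ?powR_gt0 ?subr_gt0 ?powR2_gt1//.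
by rewrite invr_gt0 subr_gt0 powRN invf_lt1 ?powR2_gt1// powR_gt0.
Qed.

(** Hedberg's sum at [t = Q / p x], uniformly in [x] through [t0 = Q / pp]. The exponent is
    [s / p x] times [1 - alpha p x / Q = p x / q x], so that the power [q x] of the bound is of
    order [m ^ s]. *)
Lemma riesz_small_scales : exists2 K : R, 0 < K & forall (f : X -> R) (x : X) (m : R),
  measurable_fun setT f -> (forall y, f y = 0 \/ 1 <= f y) ->
  (\int[mu]_y (f y `^ p y)%:E <= 1)%E -> 0 < m ->
  (forall k, avg k x (EFin \o (fun y => f y `^ (p y / s))%R) <= m%:E)%E ->
  (zsum (fun k => (dyadr k `^ alpha)%:E *
     (if (k < 0)%R then avg k x (EFin \o f) else 0)) <= (K * m `^ (s / q x))%:E)%E.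
Proof.
pose L := loc_cst Q C2 c0; have L1 : 1 <= L := loc_cst_ge1 H E.
have a0 := alpha_gt0 E; have C20 := upper_gt0 H; have Q0 := dim_gt0 H.
have pp0 : 0 < pp by exact: lt_trans ltr01 (pp_gt1 E).
pose G : R := 2 `^ alpha / (2 `^ alpha - 1) + (1 - 2 `^ (- (Q / pp - alpha)))^-1.
have G0 : 0 < G by exact: hedberg_cst_gt0.
have L0 : 0 < L by exact: lt_le_trans ltr01 L1.
have C21 : 0 < C2 + 1 by lra.
pose B := L * (C2 + 1); have B0 : 0 < B by exact: mulr_gt0.
have B10 : 0 < B + 1 by lra.
exists ((B + 1) * G * L); first by rewrite mulr_gt0// mulr_gt0.
move=> f x m mf f01 fp m0 gm.
have f0 y : 0 <= f y by case: (f01 y) => [->//|]; lra.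
have px1 := p_gt1 E x; have px0 : 0 < p x by lra.
have qx0 := q_gt0 H E x.
have tt : Q / pp <= Q / p x by rewrite ler_pM2l// lef_pV2 ?posrE// (p_le E).
have am0 : 0 < L * m `^ (s / p x) by rewrite mulr_gt0 ?powR_gt0//; lra.
have c_ge0 k : (0 <= (if (k < 0)%R then avg k x (EFin \o f) else 0))%E.
  by case: ifP => // _; apply: avg_ge0 => y; rewrite lee_fin.
apply: (le_trans (riesz_sum_le_split a0 (alpha_lt pp0 (lexx _)) tt am0 (ltW B0) c_ge0 _ _)).
- move=> k; case: ifP => [k0|_]; last by rewrite lee_fin ltW.
  by have [] := avg_local H E mp mf f01 fp m0 k0 (gm k).
- move=> k; case: ifP => [k0|_]; last by rewrite lee_fin mulr_ge0 ?powR_ge0 ?(ltW B0).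
  by have [] := avg_local H E mp mf f01 fp m0 k0 (gm k).
clearbody L; rewrite lee_fin -/G -!mulrA ler_pM2l// ler_pM2l// powRM ?powR_ge0 ?(ltW L0)//.
rewrite -powRrM.
have eE : 1 - alpha / (Q / p x) = p x / q x.
  by rewrite (q_inv E x); field; rewrite !gt_eqF.
have -> : s / p x * (1 - alpha / (Q / p x)) = s / q x.
  by rewrite eE; field; rewrite !gt_eqF.
rewrite ler_pM2r ?powR_gt0// ler1_powR// lerBlDr lerDl divr_ge0 ?(ltW a0)//.
by rewrite divr_ge0// ltW.
Qed.

(** Serves both the large scales of the high part, with [t = s], and the whole low part, with
    [t = pinf]. The extra bound by a constant [L] caps [m] at 1, which is what makes a wrong
    exponent tolerable afterwards. *)
Lemma riesz_const (t M L : R) : 1 <= t -> t <= pp -> 0 < M -> 1 <= L ->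
  exists2 K : R, 1 <= K & forall (g : X -> R) (x : X) (m : R) (c : int -> \bar R),
  measurable_fun setT g -> (forall y, 0 <= g y) ->
  (\int[mu]_y (g y `^ t)%:E <= M%:E)%E -> 0 < m ->
  (forall k, avg k x (EFin \o g) <= m%:E)%E ->
  (forall k, 0 <= c k)%E -> (forall k, c k <= L%:E)%E ->
  (forall k, c k <= L%:E * avg k x (EFin \o g))%E ->
  (zsum (fun k => (dyadr k `^ alpha)%:E * c k) <=
    (K * (Num.min 1 m) `^ (1 - alpha * t / Q))%:E)%E.
Proof.
move=> t1 tpp M0 L1; have t0 : 0 < t by lra.
have a0 := alpha_gt0 E; have C20 := upper_gt0 H; have Q0 := dim_gt0 H.
pose G : R := 2 `^ alpha / (2 `^ alpha - 1) + (1 - 2 `^ (- (Q / t - alpha)))^-1.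
have G0 : 0 < G by exact: hedberg_cst_gt0.
have G1 : 1 <= G.
  rewrite /G ler_wpDr//; last first.
    by rewrite ler_pdivlMr ?subr_gt0 ?powR2_gt1// mul1r lerBlDr lerDl.
  rewrite invr_ge0 subr_ge0 powRN invf_le1 ?powR_gt0// ltW// powR2_gt1//.
  by rewrite subr_gt0 alpha_lt.
pose B := L * ((C2 + 1) * M `^ t^-1).
have L0' : 0 < L by lra.
have C21 : 0 < C2 + 1 by lra.
have B0 : 0 < B by rewrite mulr_gt0// mulr_gt0// powR_gt0.
have B11 : 1 <= B + 1 by lra.
exists ((B + 1) * G * L); first by rewrite mulr_ege1// mulr_ege1.
move=> g x m c mg g0 gM m0 gm c_ge0 cL cg.
have w0 : 0 < Num.min 1 m by rewrite lt_min ltr01.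
have Lw0 : 0 < L * Num.min 1 m by rewrite mulr_gt0//; lra.
have L0 : (0 <= L%:E)%E by rewrite lee_fin; lra.
apply: (le_trans (riesz_sum_le_split a0 (alpha_lt t0 tpp) (lexx _) Lw0 (ltW B0) c_ge0 _ _)).
- move=> k; rewrite minEle; case: ifP => _; first by rewrite mulr1.
  by apply: (le_trans (cg k)); rewrite EFinM lee_wpmul2l.
- move=> k; apply: (le_trans (cg k)); rewrite /B -mulrA EFinM lee_wpmul2l//.
  exact: (avg_le_dyadr H mg g0 t1 k x M0 gM).
rewrite lee_fin -/G -!mulrA ler_pM2l//; last by lra.
rewrite ler_pM2l// powRM ?(ltW w0) ?(ltW L0')//.
have -> : 1 - alpha / (Q / t) = 1 - alpha * (t / Q) by field; rewrite !gt_eqF.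
rewrite ler_pM2r ?powR_gt0//.
rewrite ler1_powR// lerBlDr lerDl mulr_ge0 ?(ltW a0)//.
by rewrite divr_ge0// ltW.
Qed.

(** From [alpha / Q = 1 / p - 1 / q] one gets [(1 - alpha t / Q) q = t + (q / p) (p - t)], which
    isolates the cost of using [t] in place of [p x] in the last factor. *)
Lemma powR_q_split (K w t : R) x : 1 <= K -> 0 < w -> 1 <= t ->
  (K * w `^ (1 - alpha * t / Q)) `^ q x <=
  K `^ qmax * (w `^ t * w `^ (q x / p x * (p x - t))).
Proof.
move=> K1 w0 t1; have qx0 := q_gt0 H E x; have px0 := lt_trans ltr01 (p_gt1 E x).
rewrite powRM ?powR_ge0//; last by lra.
apply: ler_pM; rewrite ?powR_ge0//; first exact: powR_q_le H E _ _ K1.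
rewrite -powRrM -powRD; last by apply/implyP => _; rewrite gt_eqF.
suff -> : (1 - alpha * t / Q) * q x = t + q x / p x * (p x - t) by [].
have -> : alpha * t / Q = t * (1 / p x - 1 / q x) by rewrite (q_def E); ring.
by field; rewrite !gt_eqF.
Qed.

(** As [w] lies between the decay function and 1, the worst case is the decay function to the power
    [- |de|]; its logarithm is [(Q + 1) |de| ln (e + dist x x0)], controlled by the condition at
    infinity. *)
Lemma decay_power (w D de : R) x : udecay x <= w -> w <= 1 -> 0 <= D ->
  `|de| <= D * `|p x - pinf| -> w `^ de <= expR ((Q + 1) * (D * cinf)).
Proof.
move=> uw w1 D0 deD; have u0 := decay_gt0 H x0 x.
have w0 : 0 < w by exact: lt_le_trans uw.
have Q0 := dim_gt0 H.
have d1 := expR1D_gt1 H x x0.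
have l0 : 0 < ln (expR 1 + dist x x0) by rewrite ln_gt0.
apply: (@le_trans _ _ (w `^ (- `|de|))).
  by apply: ger_powR; [rewrite w0|rewrite lerNl -normrN ler_norm].
apply: (@le_trans _ _ (udecay x `^ (- `|de|))); first exact: le_powR2rN.
rewrite /decay -powRrM mulrNN /powR gt_eqF ?(lt_trans ltr01)// ler_expR -mulrA.
rewrite ler_pM2l; last by lra.
apply: (@le_trans _ _ (D * `|p x - pinf| * ln (expR 1 + dist x x0))).
  by rewrite ler_pM2r.
by rewrite -mulrA ler_wpM2l// (p_infty E).
Qed.

End core.

(** * The modular inequality for the potential *)

Section modular.
Context (R : realType) (disp : measure_display) (X : measurableType disp).
Context (dist : X -> X -> R) (mu : {measure set X -> \bar R}) (Q A0 C1 C2 : R).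
Context (alpha : R) (x0 : X) (p q : X -> R) (s pp pinf c0 cinf : R).
Hypothesis H : ahlfors_space dist mu Q A0 C1 C2.
Hypothesis E : exponents dist Q alpha x0 p q s pp pinf c0 cinf.
Hypothesis mp : measurable_fun setT p.
Local Notation ball := (qball dist).
Local Notation avg := (avg dist mu Q).
Local Notation maxfun := (maxfun dist mu Q).
Local Notation udecay := (decay dist Q x0).
Local Notation qmax := (qmax Q alpha pp).

Lemma avgD (f g : X -> \bar R) k x :
  measurable_fun setT f -> measurable_fun setT g ->
  (forall y, 0 <= f y)%E -> (forall y, 0 <= g y)%E ->
  (avg k x (fun y => f y + g y) = avg k x f + avg k x g)%E.
Proof.
move=> mf mg f0 g0; rewrite /avg ge0_integralD//.
- by rewrite ge0_muleDr// integral_ge0.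
- exact: measurable_qball H _ _.
- exact: measurable_funTS.
- exact: measurable_funTS.
Qed.

(** The added decay term keeps the bound positive, even when [g] vanishes, and large enough for
    [decay_power], at the price of an integrable error. *)
Definition majorant (g : X -> R) (x : X) : \bar R :=
  (maxfun (EFin \o g) x + (udecay x)%:E)%E.

Lemma measurable_majorant g : measurable_fun setT (majorant g).
Proof.
apply: emeasurable_funD; first exact: measurable_maxfun H _.
by apply/measurable_EFinP; exact: measurable_decay H x0.
Qed.

Lemma majorant_ge_avg g k x : (avg k x (EFin \o g) <= majorant g x)%E.
Proof.
apply: (le_trans (avg_le_maxfun dist mu Q (EFin \o g) k x)).
by rewrite leeDl// lee_fin ltW// (decay_gt0 H).
Qed.

Lemma majorant_ge_decay g x : (forall y, 0 <= g y) ->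
  ((udecay x)%:E <= majorant g x)%E.
Proof. by move=> g0; rewrite leeDr// maxfun_ge0// => y; rewrite lee_fin. Qed.

Lemma integral_majorant (t M : R) : 1 < t -> 0 < M -> exists2 K : R, 0 < K &
  forall g : X -> R, measurable_fun setT g -> (forall y, 0 <= g y) ->
  (\int[mu]_y (g y `^ t)%:E <= M%:E)%E ->
  (\int[mu]_x (majorant g x `^ t) <= K%:E)%E.
Proof.
move=> t1 M0; have [Kt Kt0 hK] := maxfun_strong_type H t1.
have [Mu Mu0 hu] := integral_decay H x0.
have t0 : 0 < t by lra.
have mu_u := measurable_decay H x0.
exists (2 `^ t * (Kt * M + Mu)); first by rewrite mulr_gt0 ?powR_gt0// addr_gt0// mulr_gt0.
move=> g mg g0 gM.
have M1 : measurable_fun setT (fun x => (maxfun (EFin \o g) x `^ t)%E).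
  exact: measurableT_comp (measurable_poweR t) (measurable_maxfun H _).
have ut_le x : ((udecay x)%:E `^ t <= (udecay x)%:E)%E.
  rewrite poweR_EFin lee_fin ge1r_powR ?(ltW t1)//.
  by rewrite (decay_gt0 H) (decay_le1 H).
have M2 : measurable_fun setT (fun x => ((udecay x)%:E)%E) by exact/measurable_EFinP.
have u0 x : (0 <= (udecay x)%:E)%E by rewrite lee_fin ltW// (decay_gt0 H).
have Mg0 x : (0 <= maxfun (EFin \o g) x)%E.
  by apply: maxfun_ge0 => y; rewrite lee_fin.
have p0 : (0 <= (2 `^ t)%R%:E :> \bar R)%E by rewrite lee_fin powR_ge0.
apply: (@le_trans _ _ (\int[mu]_x ((2 `^ t)%R%:E *
    (maxfun (EFin \o g) x `^ t + (udecay x)%:E)))%E).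
  apply: ge0_le_integral_nonmeas => x; first exact: poweR_ge0.
  apply: (le_trans (le_poweRD (Mg0 x) (u0 x) t0)).
  by rewrite lee_wpmul2l// leeD2l.
rewrite ge0_integralZl//; last 2 first.
- exact: emeasurable_funD.
- by move=> x _; rewrite adde_ge0// poweR_ge0.
rewrite EFinM lee_wpmul2l// ge0_integralD//; last first.
  by move=> x _; rewrite poweR_ge0.
rewrite EFinD leeD//; apply: (le_trans (hK _ mg g0)).
by rewrite EFinM lee_wpmul2l// lee_fin ltW.
Qed.

Lemma riesz_modular : exists2 K : R, 0 < K & forall F : X -> R,
  measurable_fun setT F -> (forall y, 0 <= F y) ->
  (\int[mu]_y (F y `^ p y)%:E <= 1)%E ->
  exists2 G : X -> \bar R,
    (forall x, riesz_sum dist mu Q alpha F x `^ q x <= G x)%E &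
    (\int[mu]_x G x <= K%:E)%E /\ measurable_fun setT G.
Proof.
have s1 := s_gt1 E; have Q0 := dim_gt0 H; have C20 := upper_gt0 H.
have /andP[spi pipp] := pinf_itv E; have ci0 := cinf_ge0 E.
have spp : s <= pp by lra.
have s0 : 0 < s by lra.
have pi1 : 1 < pinf by lra.
have pi0 : 0 < pinf by lra.
have C21 : 1 <= C2 + 1 by lra.
have [K1 K10 small] := riesz_small_scales H E mp.
have [K2 K21 large] := riesz_const H E (ltW s1) spp ltr01 C21.
have [Mu Mu0 hu] := integral_decay H x0.
(* Bound for the integral of [g2 ^ pinf]: the modular of the low part contributes 1 and the decay
   term [Mu]. *)
pose M2 := 2 `^ pinf * (1 + Mu).
have M20 : 0 < M2 by rewrite mulr_gt0 ?powR_gt0//; lra.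
pose Lx := expR ((Q + 1) * (1 * cinf)).
have Lx1 : 1 <= Lx.
  rewrite /Lx -[leLHS]expR0 ler_expR mulr_ge0//; lra.
have L31 : 1 <= C2 + Lx by lra.
have C2p0 : 0 <= C2 + 1 by lra.
have C2Lx : C2 <= C2 + Lx by lra.
have Lx0 : 0 <= Lx by lra.
have [K3 K31 low] := riesz_const H E (ltW pi1) pipp M20 L31.
have [J1 J10 int1] := integral_majorant s1 ltr01.
have [J2 J20 int2] := integral_majorant pi1 M20.
have qm0 := qmax_gt0 H E.
pose ex := expR ((Q + 1) * (qmax * cinf)); have ex0 : 0 < ex by exact: expR_gt0.
(* A constant at least 1 is needed to pass from the power [q x] to [qmax]. *)
pose K1' := Num.max K1 1.
have K1'1 : 1 <= K1' by rewrite le_max lexx orbT.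
have K1'K : K1 <= K1' by rewrite le_max lexx.
pose a1 := K1' `^ qmax + 2 `^ qmax * K2 `^ qmax.
pose a2 := 2 `^ qmax * (K3 `^ qmax * ex).
have K1'0 : 0 < K1' by lra.
have K20 : 0 < K2 by lra.
have K30 : 0 < K3 by lra.
have a10 : 0 < a1 by rewrite addr_gt0// ?mulr_gt0// powR_gt0.
have a20 : 0 < a2 by rewrite mulr_gt0 ?powR_gt0// mulr_gt0 ?powR_gt0.
pose KK := 2 `^ qmax * (a1 + a2).
have KK0 : 0 < KK by rewrite mulr_gt0 ?powR_gt0// addr_gt0.
exists (KK * (J1 + J2)); first by rewrite mulr_gt0// addr_gt0.
move=> F mF F0 Fp.
have px0 y : 0 < p y by exact: lt_trans ltr01 (p_gt1 E y).
pose f1 y := if 1 < F y then F y else 0.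
pose f2 y := if 1 < F y then 0 else F y.
have mlt : measurable_fun setT (fun y => 1 < F y) by exact: measurable_fun_ltr.
have mf1 : measurable_fun setT f1 by exact: measurable_fun_ifT.
have mf2 : measurable_fun setT f2 by exact: measurable_fun_ifT.
have f10 y : 0 <= f1 y by rewrite /f1; case: ifP.
have f20 y : 0 <= f2 y by rewrite /f2; case: ifP.
have f21 y : f2 y <= 1 by rewrite /f2; case: ltP => //; lra.
have f11 y : f1 y = 0 \/ 1 <= f1 y.
  by rewrite /f1; case: ltP => [/ltW|]; [right|left].
have F12 y : F y = f1 y + f2 y.
  by rewrite /f1 /f2; case: ifP; rewrite ?addr0 ?add0r.
have ple (f : X -> R) : (forall y, 0 <= f y) -> (forall y, f y <= F y) ->
    (\int[mu]_y (f y `^ p y)%:E <= 1)%E.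
  move=> f0 fF; apply: le_trans Fp; apply: ge0_le_integral_nonmeas => y.
    by rewrite lee_fin powR_ge0.
  by rewrite lee_fin le_powR2r// ltW.
have f1p : (\int[mu]_y (f1 y `^ p y)%:E <= 1)%E.
  by apply: ple => // y; rewrite F12 lerDl.
have f2p : (\int[mu]_y (f2 y `^ p y)%:E <= 1)%E.
  by apply: ple => // y; rewrite F12 lerDr.
pose g1 y := f1 y `^ (p y / s).
have mg1 : measurable_fun setT g1.
  by apply: measurable_pow => //; [exact: measurable_funM|move=> y; rewrite divr_gt0].
have g10 y : 0 <= g1 y by exact: powR_ge0.
have g1s : (\int[mu]_y (g1 y `^ s)%:E <= 1%:E)%E.
  apply: le_trans f1p; rewrite le_eqVlt; apply/orP; left; apply/eqP.
  by apply: eq_integral => y _; rewrite /g1 -powRrM divfK// gt_eqF.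
have f1g1 y : f1 y <= g1 y.
  rewrite /g1; have [->|f1y] := f11 y; first exact: powR_ge0.
  by rewrite le1r_powR// ler_pdivlMr// mul1r (p_ge E).
pose h2 y := f2 y `^ (p y / pinf).
have mh2 : measurable_fun setT h2.
  by apply: measurable_pow => //; [exact: measurable_funM|move=> y; rewrite divr_gt0].
pose g2 y := h2 y + udecay y.
have mu_u := measurable_decay H x0.
have u0 y := decay_gt0 H x0 y.
have mg2 : measurable_fun setT g2 by exact: measurable_funD.
have h20 y : 0 <= h2 y by exact: powR_ge0.
have g20 y : 0 <= g2 y by rewrite addr_ge0// ltW.
have mEF (f : X -> R) : measurable_fun setT f -> measurable_fun setT (EFin \o f).
  by move=> mf; exact/measurable_EFinP.
have mpw (f : X -> R) : measurable_fun setT f -> (forall y, 0 <= f y) ->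
    measurable_fun setT (fun y => (f y `^ p y)%:E).
  by move=> mf f0; apply/measurable_EFinP; exact: measurable_pow.
have g2s : (\int[mu]_y (g2 y `^ pinf)%:E <= M2%:E)%E.
  apply: (@le_trans _ _ (\int[mu]_y ((2 `^ pinf)%:E *
      ((f2 y `^ p y)%:E + (udecay y)%:E)))%E).
    apply: ge0_le_integral_nonmeas => y; first by rewrite lee_fin powR_ge0.
    rewrite -EFinD -EFinM lee_fin.
    apply: (le_trans (le_powRD (h20 y) (ltW (u0 y)) (ltW pi0))).
    rewrite ler_pM2l ?powR_gt0// lerD//.
      by rewrite /h2 -powRrM divfK// gt_eqF.
    by rewrite ge1r_powR ?u0 ?(decay_le1 H) ?(ltW pi1).
  have ma : measurable_fun setT (fun y => (f2 y `^ p y)%:E) by exact: mpw.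
  have mb : measurable_fun setT (fun y => (udecay y)%:E) by exact: mEF.
  have pa y : [set: X] y -> (0 <= (f2 y `^ p y)%:E)%E by rewrite lee_fin powR_ge0.
  have pb y : [set: X] y -> (0 <= (udecay y)%:E)%E by rewrite lee_fin ltW.
  have p2 : (0 <= (2 `^ pinf)%:E :> \bar R)%E by rewrite lee_fin powR_ge0.
  rewrite ge0_integralZl//; last 2 first.
  - exact: emeasurable_funD.
  - by move=> y _; rewrite adde_ge0 ?pa ?pb.
  rewrite /M2 EFinM lee_wpmul2l// ge0_integralD//.
  by rewrite (EFinD 1); apply: leeD.
(* Where [f2] is below the decay function, the second summand of [g2] suffices; elsewhere [f2] is
   [h2] times [f2 ^ (1 - p / pinf)], a factor bounded by [decay_power]. *)
have f2g2 y : f2 y <= Lx * g2 y.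
  have [uf|/ltW fu] := leP (udecay y) (f2 y); last first.
    apply: (le_trans fu); apply: (@le_trans _ _ (g2 y)); first by rewrite /g2 lerDr.
    by rewrite ler_peMl.
  apply: (@le_trans _ _ (Lx * h2 y)); last first.
    by rewrite ler_wpM2l// lerDl ltW.
  have f2y0 : 0 < f2 y by exact: lt_le_trans uf.
  have {1}-> : f2 y = f2 y `^ (1 - p y / pinf) * h2 y.
    rewrite /h2 -powRD ?subrK ?powRr1//.
    by apply/implyP => _; rewrite gt_eqF.
  rewrite ler_wpM2r// /Lx; apply: (decay_power H E (x := y)) => //.
  have -> : 1 - p y / pinf = - ((p y - pinf) / pinf) by field; rewrite gt_eqF.
  rewrite normrN normrM mul1r normfV [X in _ / X]gtr0_norm// ler_pdivrMr//.
  by rewrite ler_peMr// ltW.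
have mf1E := mEF _ mf1; have mf2E := mEF _ mf2.
have mg1E := mEF _ mg1; have mg2E := mEF _ mg2.
have E0 (f : X -> R) : (forall y, 0 <= f y) -> forall y, (0 <= (EFin \o f) y)%E.
  by move=> f0 y; rewrite lee_fin.
pose G x := (KK%:E * (majorant g1 x `^ s + majorant g2 x `^ pinf))%E.
exists G; last split.
- move=> x; have qx0 := q_gt0 H E x.
  have m1u := majorant_ge_decay x g10; have m2u := majorant_ge_decay x g20.
  have Kpos : (0%E < KK%:E)%E by rewrite lte_fin.
  have m1a := fun k => majorant_ge_avg g1 k x.
  have m2a := fun k => majorant_ge_avg g2 k x.
  rewrite /G.
  move: m1u m2u m1a m2a.
  (* Where a majorant is infinite so is [G], and nothing remains to be shown. *)
  case: (majorant g1 x) => [m1| |//]; last first.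
    rewrite poweRyr ?gt_eqF// addye ?gt0_muley ?leey//.
    by rewrite -ltNye (lt_le_trans ltNy0)// poweR_ge0.
  case: (majorant g2 x) => [m2| |//]; last first.
    rewrite [(+oo `^ pinf)%E]poweRyr ?gt_eqF// addey ?gt0_muley ?leey//.
  rewrite !lee_fin => m1u m2u m1a m2a.
  have m10 : 0 < m1 by exact: lt_le_trans m1u.
  have m20 : 0 < m2 by exact: lt_le_trans m2u.
  (* Three pieces: radii below 1 and radii at least 1 for the high part, and all radii for the low
     part. *)
  pose c1 k := (if (k < 0)%R then avg k x (EFin \o f1) else 0)%E.
  pose c2 k := (if (k < 0)%R then 0 else avg k x (EFin \o f1))%E.
  pose c3 k := avg k x (EFin \o f2).
  have c10 k : (0 <= c1 k)%E by rewrite /c1; case: ifP => // _; apply: avg_ge0; exact: E0.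
  have c20 k : (0 <= c2 k)%E by rewrite /c2; case: ifP => // _; apply: avg_ge0; exact: E0.
  have c30 k : (0 <= c3 k)%E by apply: avg_ge0; exact: E0.
  pose T (c : int -> \bar R) := zsum (fun k => (dyadr k `^ alpha)%:E * c k)%E.
  have T0 c : (forall k, 0 <= c k)%E -> (0 <= T c)%E.
    by move=> ch; apply: zsum_ge0 => k; rewrite mule_ge0 ?lee_fin ?powR_ge0.
  have dec : riesz_sum dist mu Q alpha F x = (T c1 + (T c2 + T c3))%E.
    have ct0 c : (forall k, 0 <= c k)%E ->
        forall k, (0 <= (dyadr k `^ alpha)%:E * c k)%E.
      by move=> ch k; rewrite mule_ge0 ?lee_fin ?powR_ge0.
    rewrite /T -(zsumD (ct0 _ c20) (ct0 _ c30)) -zsumD; last 2 first.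
    + exact: ct0.
    + by move=> k; rewrite adde_ge0 ?ct0.
    rewrite /riesz_sum; congr zsum; apply/funext => k.
    rewrite -!ge0_muleDr// ?adde_ge0//; congr (_ * _)%E.
    rewrite /c3 (_ : EFin \o F = fun y => ((EFin \o f1) y + (EFin \o f2) y)%E); last first.
      by apply/funext => y /=; rewrite F12.
    rewrite avgD//.
    by rewrite addeA; congr (_ + _)%E; rewrite /c1 /c2; case: ifP; rewrite ?adde0 ?add0e.
  have T1 : (T c1 `^ q x <= (K1' `^ qmax * m1 `^ s)%:E)%E.
    have := small f1 x m1 mf1 f11 f1p m10 m1a; rewrite -/(T c1) => h.
    apply: (@le_trans _ _ ((K1' * m1 `^ (s / q x))%:E `^ q x)%E).
      apply: gt0_ler_poweR; rewrite ?in_itv/= ?leey ?andbT ?T0 ?(ltW qx0)//.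
        by rewrite lee_fin mulr_ge0 ?powR_ge0// ltW.
      by apply: (le_trans h); rewrite lee_fin ler_wpM2r// powR_ge0.
    rewrite poweR_EFin lee_fin powRM ?powR_ge0 ?(ltW K1'0)//.
    rewrite -powRrM divfK ?gt_eqF// ler_pM2r ?powR_gt0//.
    by apply: (powR_q_le H E).
  have step (t K m : R) c : 1 <= t -> 1 <= K -> 0 < m -> (forall k, 0 <= c k)%E ->
    (T c <= (K * Num.min 1 m `^ (1 - alpha * t / Q))%:E)%E ->
    (T c `^ q x <= (K `^ qmax * (Num.min 1 m `^ t *
        Num.min 1 m `^ (q x / p x * (p x - t))))%:E)%E.
    move=> t1 K_1 m0 ch h.
    have w0 : 0 < Num.min 1 m by rewrite lt_min ltr01.
    apply: (@le_trans _ _ ((K * Num.min 1 m `^ (1 - alpha * t / Q))%:E `^ q x)%E).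
      apply: gt0_ler_poweR; rewrite ?in_itv/= ?leey ?andbT ?T0 ?(ltW qx0)//.
      by rewrite lee_fin mulr_ge0 ?powR_ge0// (le_trans ler01).
    by rewrite poweR_EFin lee_fin; apply: (powR_q_split H E).
  have min_le (m t : R) : 0 < m -> 0 < t -> Num.min 1 m `^ t <= m `^ t.
    move=> m0 t0; rewrite le_powR2r ?(ltW t0)//; first by rewrite le_min ler01 ltW.
    by rewrite ge_min lexx orbT.
  have T2 : (T c2 `^ q x <= (K2 `^ qmax * m1 `^ s)%:E)%E.
    have avg_g k : (avg k x (EFin \o f1) <= avg k x (EFin \o g1))%E.
      apply: (le_avg H) => //.
      by move=> y _; rewrite lee_fin.
    have h : (T c2 <= (K2 * Num.min 1 m1 `^ (1 - alpha * s / Q))%:E)%E.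
      apply: (large g1) => // k.
      + rewrite /c2; case: ltP => [_|k0]; first by rewrite lee_fin.
        apply: (le_trans (avg_g k)).
        apply: (le_trans (avg_le_dyadr H mg1 g10 (ltW s1) k x ltr01 g1s)).
        rewrite lee_fin powR1 mulr1 ler_piMr//.
        (* The restriction to [k >= 0] turns the decay bound into a bound by the constant
           [C2 + 1]. *)
        have r1 : 1 <= dyadr k :> R.
          rewrite (_ : 1 = dyadr 0); first exact: le_dyadr.
          by rewrite /dyadr expr0z.
        rewrite powRN invf_le1 ?powR_gt0 ?dyadr_gt0//.
        by rewrite -[leLHS](powRr0 (dyadr k)) ler_powR// divr_ge0 ?(ltW Q0) ?(ltW s0).
      + have ag0 : (0 <= avg k x (EFin \o g1))%E by apply: avg_ge0; exact: E0.
        rewrite /c2; case: ltP => [_|k0].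
          by rewrite mule_ge0// lee_fin.
        apply: (le_trans (avg_g k)); rewrite -[leLHS]mul1e lee_wpmul2r//.
    have := step s K2 m1 c2 (ltW s1) K21 m10 c20 h.
    move=> /le_trans; apply; rewrite lee_fin ler_pM2l ?powR_gt0//.
    (* The mismatch factor is at most 1, its base being at most 1 and [p x - s] nonnegative. *)
    apply: le_trans (min_le _ _ m10 s0); rewrite ler_piMr ?powR_ge0//.
    rewrite -[leRHS](powRr0 (Num.min 1 m1)); apply: ger_powR.
      by rewrite lt_min ltr01 m10/= ge_min lexx.
    by rewrite mulr_ge0 ?subr_ge0 ?(p_ge E)// divr_ge0// ltW.
  have T3 : (T c3 `^ q x <= (K3 `^ qmax * ex * m2 `^ pinf)%:E)%E.
    have h : (T c3 <= (K3 * Num.min 1 m2 `^ (1 - alpha * pinf / Q))%:E)%E.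
      apply: (low g2) => // k.
      + have f2c y : ball x (dyadr k) y -> ((EFin \o f2) y <= 1%:E + 0%:E * (EFin \o f2) y)%E.
          by move=> _; rewrite mul0e adde0 lee_fin.
        apply: (le_trans (avg_le_affine H mf2E mf2E (E0 _ f20) (E0 _ f20) ler01 (lexx 0) f2c)).
        by rewrite mul0e adde0 mulr1 lee_fin.
      + have ag0 : (0 <= avg k x (EFin \o g2))%E by apply: avg_ge0; exact: E0.
        have f2c y : ball x (dyadr k) y ->
            ((EFin \o f2) y <= 0%:E + Lx%:E * (EFin \o g2) y)%E.
          by move=> _; rewrite add0e lee_fin.
        apply: (le_trans (avg_le_affine H mf2E mg2E (E0 _ f20) (E0 _ g20) (lexx 0) Lx0 f2c)).
        by rewrite mulr0 add0e lee_wpmul2r// lee_fin lerDr ltW.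
    have := step pinf K3 m2 c3 (ltW pi1) K31 m20 c30 h.
    move=> /le_trans; apply; rewrite lee_fin -[leRHS]mulrA ler_pM2l ?powR_gt0//.
    rewrite [leLHS]mulrC.
    apply: ler_pM; rewrite ?powR_ge0//; last exact: min_le.
    (* Now [p x - pinf] has no definite sign and the lower bound of [m2] by the decay function is
       needed; [D = qmax] works since [q / p <= q <= qmax]. *)
    rewrite /ex; apply: (decay_power H E (x := x)); rewrite ?(ltW qm0)//.
    + by rewrite le_min m2u (decay_le1 H).
    + by rewrite ge_min lexx.
    + rewrite normrM ler_wpM2r// gtr0_norm ?divr_gt0//.
      apply: le_trans (q_le_max H E x); rewrite ler_pdivrMr// ler_peMr ?(ltW qx0)//.
      exact/ltW/(p_gt1 E).
  have c230 : (0 <= T c2 + T c3)%E by rewrite adde_ge0 ?T0.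
  rewrite dec; apply: (le_trans (le_poweRD (T0 _ c10) c230 qx0)).
  apply: (@le_trans _ _ ((2 `^ qmax)%R%:E * ((K1' `^ qmax * m1 `^ s)%:E +
     (2 `^ qmax)%R%:E * ((K2 `^ qmax * m1 `^ s)%:E + (K3 `^ qmax * ex * m2 `^ pinf)%:E)))%E).
    have two : ((2 `^ q x)%R%:E <= (2 `^ qmax)%R%:E :> \bar R)%E.
      by rewrite lee_fin; apply: (powR_q_le H E); rewrite ler1n.
    have two0 : (0 <= (2 `^ q x)%R%:E :> \bar R)%E by rewrite lee_fin powR_ge0.
    apply: lee_pmul => //; first by rewrite adde_ge0// poweR_ge0.
    apply: leeD => //; apply: (le_trans (le_poweRD (T0 _ c20) (T0 _ c30) qx0)).
    apply: lee_pmul => //; first by rewrite adde_ge0// poweR_ge0.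
    exact: leeD.
  rewrite !poweR_EFin -!(EFinD, EFinM) lee_fin /KK -[leRHS]mulrA.
  rewrite ler_pM2l ?powR_gt0//.
  have z1 : 0 <= a2 * m1 `^ s by rewrite mulr_ge0 ?powR_ge0// ltW.
  have z2 : 0 <= a1 * m2 `^ pinf by rewrite mulr_ge0 ?powR_ge0// ltW.
  rewrite [leLHS](_ : _ = a1 * m1 `^ s + a2 * m2 `^ pinf); last first.
    by rewrite /a1 /a2; ring.
  rewrite [leRHS](_ : _ = a1 * m1 `^ s + a2 * m2 `^ pinf +
    (a2 * m1 `^ s + a1 * m2 `^ pinf)); last by ring.
  by rewrite lerDl addr_ge0.
- have mm (g : X -> R) t : measurable_fun setT (fun x => (majorant g x `^ t)%E).
    exact: measurableT_comp (measurable_poweR t) (measurable_majorant g).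
  rewrite /G ge0_integralZl//; last 3 first.
  + exact: emeasurable_funD.
  + by move=> x _; rewrite adde_ge0// poweR_ge0.
  + by rewrite lee_fin ltW.
  rewrite (EFinM KK) lee_wpmul2l ?lee_fin ?(ltW KK0)// ge0_integralD//; last 2 first.
  + by move=> x _; rewrite poweR_ge0.
  + by move=> x _; rewrite poweR_ge0.
  by rewrite EFinD leeD// ?int1 ?int2.
- apply: measurable_funeM; apply: emeasurable_funD;
  exact: measurableT_comp (measurable_poweR _) (measurable_majorant _).
Qed.

End modular.

(** * Log-Hoelder exponents *)

Section exponents_of_log_holder.
Context (R : realType) (disp : measure_display) (X : measurableType disp).
Context (dist : X -> X -> R) (mu : {measure set X -> \bar R}) (Q A0 C1 C2 : R).
Hypothesis H : ahlfors_space dist mu Q A0 C1 C2.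
Local Notation ball := (qball dist).

(* Balls have positive measure. *)
Lemma ae_everywhere (P : X -> Prop) :
  (forall x, ~ P x -> exists2 r : R, 0 < r & forall y, dist x y < r -> ~ P y) ->
  (\forall x \ae mu, P x) -> forall x, P x.
Proof.
move=> oP [N [mN N0 PN]] x; apply: contrapT => nPx.
have [r r0 rP] := oP x nPx.
have : (mu (ball x r) <= mu N)%E.
  apply: le_measure; rewrite ?inE//; first exact: measurable_qball H _ _.
  by move=> y /rP; exact: PN.
rewrite N0; apply/negP; rewrite -ltNge.
apply: lt_le_trans (mu_qball_ge H x r0).
by rewrite lte_fin mulr_gt0 ?powR_gt0// (lower_gt0 H).
Qed.

Lemma log_holder_local (p : X -> R) : LH0 dist p -> exists2 c0 : R, 0 <= c0 &
  forall x y (r : R), 0 < r <= 2^-1 -> dist x y < r ->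
    `|p x - p y| * - ln r <= c0.
Proof.
move=> [C0 h]; exists (Num.max C0 0); first by rewrite le_max lexx orbT.
move=> x y r /andP[r0 r2] xy.
have [->|/eqP xny] := pselect (x = y).
  by rewrite subrr normr0 mul0r le_max lexx orbT.
have d0 : 0 < dist x y.
  rewrite lt_neqAle (dist_ge0 H) andbT eq_sym; apply/eqP => /(dist_eq0 H) e.
  by rewrite e eqxx in xny.
have d1 : dist x y < 1 by lra.
have l0 : 0 < - ln (dist x y) by rewrite oppr_gt0 ln_lt0// d0 d1.
have := h x y (elimN eqP xny); rewrite div1r => /(_ (lt_le_trans xy r2)).
have -> : - C0 / ln (dist x y) = C0 / - ln (dist x y).
  by rewrite invrN mulrN mulNr.
rewrite ler_pdivlMr// => hc; rewrite le_max; apply/orP; left; apply: le_trans hc.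
by rewrite ler_wpM2l// lerN2 ler_ln ?posrE// ltW.
Qed.

(** Continuity is what turns the essential bounds of [p] into bounds at every point. *)
Lemma log_holder_continuous (p : X -> R) (x : X) (e : R) : LH0 dist p -> 0 < e ->
  exists2 r : R, 0 < r & forall y, dist x y < r -> `|p x - p y| < e.
Proof.
move=> /log_holder_local[c0 c00 loc] e0.
pose r := Num.min 2^-1 (expR (- ((c0 + 1) / e))).
have r0 : 0 < r by rewrite lt_min invr_gt0 ltr0n expR_gt0.
exists r => // y xy.
have := loc x y r; rewrite r0 /= => /(_ _ xy)/=.
have -> : r <= 2^-1 by rewrite ge_min lexx.
move=> /(_ isT) h.
have lr : (c0 + 1) / e <= - ln r.
  rewrite lerNr -[leRHS]expRK ler_ln ?posrE ?expR_gt0//.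
  by rewrite ge_min lexx orbT.
rewrite ltNge; apply/negP => ep.
have : c0 + 1 <= `|p x - p y| * - ln r.
  have -> : c0 + 1 = e * ((c0 + 1) / e) by field; rewrite gt_eqF.
  apply: ler_pM => //; first exact: ltW.
  by rewrite divr_ge0 ?ltW//; lra.
lra.
Qed.

Lemma exponents_of_log_holder (alpha : R) (x0 : X) (p q : X -> R) :
  0 < alpha -> LH dist x0 p ->
  (1 < ess_inf mu (EFin \o p))%E ->
  (ess_sup mu (EFin \o p) < (Q / alpha)%:E)%E ->
  (forall x, 1 / p x - 1 / q x = alpha / Q) ->
  exists s pp pinf c0 cinf, exponents dist Q alpha x0 p q s pp pinf c0 cinf.
Proof.
move=> a0 [hloc [Ci [pinf hinf]]] hi hs hq.
have [c0 c00 loc] := log_holder_local hloc.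
have [s s1 si] : exists2 s : R, 1 < s & (s%:E <= ess_inf mu (EFin \o p))%E.
  (* An infinite essential infimum is not excluded at this point; any [s > 1] then serves. *)
  move: hi; case: (ess_inf _ _) => [r| |//]; last by exists 2; rewrite ?ltr1n ?leey.
  by rewrite lte_fin => r1; exists r.
have ps x : s <= p x.
  apply: (@ae_everywhere (fun x => s <= p x)).
    move=> y /negP; rewrite -ltNge => pys.
    have e0 : 0 < s - p y by lra.
    have [r r0 hr] := log_holder_continuous y hloc e0.
    exists r => // z /hr; rewrite ltr_norml => /andP[z1 z2]; apply/negP; rewrite -ltNge.
    lra.
  have := ess_inf_le mu (EFin \o p); apply: filterS => y /(le_trans si).
  by rewrite lee_fin.
have [pp ppQ ppi] : exists2 pp : R, pp < Q / alpha &
    (ess_sup mu (EFin \o p) <= pp%:E)%E.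
  move: hs; case: (ess_sup _ _) => [r| |] //.
    by rewrite lte_fin => r1; exists r.
  by exists (Q / alpha - 1); [lra|rewrite leNye].
have ppx x : p x <= pp.
  apply: (@ae_everywhere (fun x => p x <= pp)).
    move=> y /negP; rewrite -ltNge => pys.
    have e0 : 0 < p y - pp by lra.
    have [r r0 hr] := log_holder_continuous y hloc e0.
    exists r => // z /hr; rewrite ltr_norml => /andP[z1 z2]; apply/negP; rewrite -ltNge.
    lra.
  have := ess_sup_ge mu (EFin \o p); apply: filterS => y /le_trans /(_ ppi).
  by rewrite lee_fin.
pose ci := Num.max Ci 0.
have ci0 : 0 <= ci by rewrite le_max lexx orbT.
have inf x : `|p x - pinf| * ln (expR 1 + dist x x0) <= ci.
  have l0 : 0 < ln (expR 1 + dist x x0) by rewrite ln_gt0// (expR1D_gt1 H).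
  by have := hinf x; rewrite ler_pdivlMr// => /le_trans; apply; rewrite le_max lexx.
(* At distance [expR (ci / e + 1)] the logarithm exceeds [ci / e], so [p] is within [e] of [pinf]
   there; hence [pinf] inherits the bounds [s] and [pp]. *)
have near_inf e : 0 < e -> exists y, `|p y - pinf| < e.
  move=> e0; have [y hy] := dist_unbounded H x0 (expR (ci / e + 1)).
  exists y; rewrite ltNge; apply/negP => ep.
  have l1 : ci / e + 1 <= ln (expR 1 + dist y x0).
    rewrite -[leLHS]expRK ler_ln ?posrE ?expR_gt0//; last first.
      by rewrite (lt_trans ltr01)// (expR1D_gt1 H).
    by rewrite (distC H y); have := expR_ge0 (1 : R); lra.
  have : ci + e <= `|p y - pinf| * ln (expR 1 + dist y x0).
    have -> : ci + e = e * (ci / e + 1) by field; rewrite gt_eqF.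
    apply: ler_pM => //; first exact: ltW.
    by rewrite addr_ge0// divr_ge0// ltW.
  by have := inf y; lra.
exists s, pp, pinf, c0, ci; split => //.
- apply/andP; split; rewrite leNgt; apply/negP => h.
    have e0 : 0 < s - pinf by lra.
    have [y] := near_inf _ e0; rewrite ltr_norml => /andP[h1 h2].
    by have := ps y; lra.
  have e0 : 0 < pinf - pp by lra.
  have [y] := near_inf _ e0; rewrite ltr_norml => /andP[h1 h2].
  by have := ppx y; lra.
- move=> x y r r2 xy; apply: le_trans (loc x y r r2 xy).
  have r1 : r < 1.
    by move/andP: r2 => [_ /le_lt_trans]; apply; rewrite invf_lt1 ?ltr1n.
  rewrite ler_wpM2r ?ler_norm// oppr_ge0 ln_le0// ltW//.
Qed.

End exponents_of_log_holder.

(** * From modulars to norms *)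

Section norms.
Context (R : realType) (disp : measure_display) (X : measurableType disp).
Context (mu : {measure set X -> \bar R}).

Lemma vmodular_EFin (p : X -> R) (f : X -> \bar R) :
  (vmodular mu (EFin \o p) f = \int[mu]_x (`|f x| `^ p x))%E.
Proof.
have O0 : Omega_infty (EFin \o p) = set0 by apply/seteqP; split.
by rewrite /vmodular O0 setC0 erestrict_set0 Lnorm0// adde0.
Qed.

(** Every [l] admissible for [f] makes [C * l] admissible for [g], so the infima compare without
    being attained, also when no [l] is admissible. *)
Lemma vnorm_le_scale (p q : X -> \bar R) (f g : X -> \bar R) (C : R) : 0 < C ->
  (forall l : R, 0 < l -> (vmodular mu p (vscale f l) <= 1)%E ->
    (vmodular mu q (vscale g (C * l)) <= 1)%E) ->
  (vnorm mu q g <= C%:E * vnorm mu p f)%E.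
Proof.
move=> C0 h; rewrite -lee_pdivrMl//; apply/ereal_infP => _ [l [l0 hl] <-].
rewrite lee_pdivrMl// -EFinM; apply: ereal_inf_lbound.
by exists (C * l) => //; split; [rewrite mulr_gt0|exact: h].
Qed.

End norms.

(** * The fractional integral operators *)

Section boundedness.
Context (R : realType) (disp : measure_display) (X : measurableType disp).
Context (dist : X -> X -> R) (mu : {measure set X -> \bar R}) (Q A0 C1 C2 : R).
Context (alpha : R) (x0 : X) (p q : X -> R) (s pp pinf c0 cinf : R).
Hypothesis H : ahlfors_space dist mu Q A0 C1 C2.
Hypothesis E : exponents dist Q alpha x0 p q s pp pinf c0 cinf.
Hypothesis mp : measurable_fun setT p.
Hypothesis aQ : alpha < Q.

Lemma riesz_sumZ (F : X -> R) (l : R) x : measurable_fun setT F ->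
  (forall y, 0 <= F y) -> 0 <= l ->
  (riesz_sum dist mu Q alpha (fun y => l * F y)%R x =
   l%:E * riesz_sum dist mu Q alpha F x)%E.
Proof.
move=> mF F0 l0.
have aF k : (0 <= avg dist mu Q k x (EFin \o F))%E.
  by apply: avg_ge0 => y; rewrite lee_fin.
rewrite /riesz_sum -zsumZl//; last first.
  by move=> k; rewrite mule_ge0// lee_fin powR_ge0.
congr zsum; apply/funext => k; rewrite [RHS]muleCA; congr (_ * _)%E.
have mB := measurable_qball H x (dyadr k).
have mFB : measurable_fun (qball dist x (dyadr k)) (fun y => (F y)%:E).
  by apply: measurable_funTS; exact/measurable_EFinP.
have FB0 y : qball dist x (dyadr k) y -> (0 <= (F y)%:E)%E by rewrite lee_fin.
by rewrite /avg muleCA -(ge0_integralZl mu mB mFB FB0)// lee_fin.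
Qed.

(* [k] is a kernel dominated by a multiple of [dist x y `^ (alpha - Q)] off the
   diagonal; no measurability of [k] is needed. *)
Lemma kernel_operator_bounded (k : X -> X -> \bar R) (D : R) : 0 < D ->
  (forall x y, y <> x -> `|k x y| <= (D / dist x y `^ (Q - alpha))%:E)%E ->
  exists2 C : R, 0 < C & forall f : X -> \bar R, measurable_fun setT f ->
  (vnorm mu (EFin \o q) (fun x => \int[mu]_y (f y * k x y)) <=
   C%:E * vnorm mu (EFin \o p) f)%E.
Proof.
move=> D0 kD; have [K K0 hK] := riesz_modular H E mp.
pose D' := 2 `^ (Q - alpha) * D.
have D'0 : 0 < D' by rewrite mulr_gt0// powR_gt0.
(* Dividing the potential by [K + 1] brings its modular from [K] below 1: as [q x >= 1], the factor
   [(K + 1) ^ (- q x)] is at most [1 / (K + 1)]. *)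
pose C := D' * (K + 1).
have C0 : 0 < C by rewrite mulr_gt0//; lra.
exists C => // f mf; apply: vnorm_le_scale => // l l0.
rewrite !vmodular_EFin => fp.
have li0 : 0 < l^-1 by rewrite invr_gt0.
have px0 y : 0 < p y by exact: lt_trans ltr01 (p_gt1 E y).
have mabs : measurable_fun setT (fun y => `|f y|%E).
  exact: measurableT_comp (@abse_measurable R setT) mf.
(* A real-valued version of [|f| / l]: [fine] sends infinite values to 0, and the set [N] where this
   alters [f] is shown to be null. *)
pose F y := fine `|f y|%E * l^-1.
have F0 y : 0 <= F y by rewrite mulr_ge0 ?fine_ge0// ltW.
have mF : measurable_fun setT F.
  apply: measurable_funM => //.
  exact: measurableT_comp (@fine_measurable R setT measurableT) mabs.
pose N := [set y | (+oo <= `|f y|)%E].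
have mN : measurable N.
  by rewrite -[X in measurable X]setTI; exact: emeasurable_fun_c_infty.
have absF y : ~ N y -> (`|f y| = (l * F y)%:E)%E.
  rewrite /N/= => /negP; rewrite leye_eq -ltey => fy.
  rewrite /F mulrCA divff ?gt_eqF// mulr1 fineK// ge0_fin_numE//.
have Fp : (\int[mu]_y (F y `^ p y)%:E <= 1)%E.
  apply: le_trans fp; apply: ge0_le_integral_nonmeas => y.
    by rewrite lee_fin powR_ge0.
  have [Ny|Ny] := pselect (N y).
    have /eqP -> : F y == 0.
      by move: Ny; rewrite /N/= leye_eq /F => /eqP ->; rewrite mul0r.
    by rewrite powR0 ?gt_eqF// poweR_ge0.
  rewrite /vscale abseM (absF _ Ny) [(`|(l^-1)%:E|)%E]gee0_abs ?lee_fin ?(ltW li0)//.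
  by rewrite mulrAC divff ?gt_eqF// mul1r.
have N0 : mu N = 0%E.
  apply/eqP/negPn/negP => muN.
  (* The integrand of the modular is infinite on [N], which is impossible on a set of positive
     measure. *)
  have : (\int[mu]_y (+oo * (\1_N y)%:E) <= 1)%E.
    apply: le_trans fp; apply: ge0_le_integral_nonmeas => y.
      by rewrite mule_ge0// lee_fin.
    rewrite indicE; have [Ny|Ny] := pselect (N y).
      rewrite mem_set// mule1 /vscale abseM.
      rewrite [(`|(l^-1)%:E|)%E]gee0_abs ?lee_fin ?(ltW li0)//.
      move: Ny; rewrite /N/= leye_eq => /eqP ->.
      by rewrite gt0_mulye ?lte_fin// poweRyr ?gt_eqF.
    by rewrite memNset// mule0 poweR_ge0.
  have mI1 : measurable_fun setT (fun y => (\1_N y)%:E : \bar R).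
    by apply/measurable_EFinP; exact: measurable_indic.
  have I01 y : [set: X] y -> (0 <= (\1_N y)%:E :> \bar R)%E by rewrite lee_fin.
  rewrite ge0_integralZl// integral_indic// setIT gt0_mulye//.
  by rewrite lt_neqAle eq_sym muN measure_ge0.
have [G hG [IG mG]] := hK F mF F0 Fp.
have bound x : (`|\int[mu]_y (f y * k x y)| <=
    (D' * l)%:E * riesz_sum dist mu Q alpha F x)%E.
  pose g y := `|f y * k x y|%E.
  apply: (le_trans (@abse_integral_le _ _ _ mu _ g (fun y => lexx _))).
  have mDF : measurable_fun setT (fun y => (D * l) * F y) by exact: measurable_funM.
  have Dl0 : 0 <= D * l by rewrite mulr_ge0// ltW.
  have DF0 y : 0 <= D * l * F y by exact: mulr_ge0.
  have -> : ((D' * l)%:E * riesz_sum dist mu Q alpha F x =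
      (2 `^ (Q - alpha))%:E * riesz_sum dist mu Q alpha (fun y => (D * l) * F y)%R x)%E.
    by rewrite riesz_sumZ// muleA -EFinM /D' mulrA.
  apply: (integral_le_riesz_sum H aQ mDF DF0 mN N0) => y.
    exact: abse_ge0.
  move=> Ny yx; rewrite /g abseM (absF _ Ny).
  apply: (@le_trans _ _ ((l * F y)%:E * (D / dist x y `^ (Q - alpha))%:E)%E).
    by rewrite lee_wpmul2l ?kD// lee_fin mulr_ge0// ltW.
  by rewrite -EFinM lee_fin [leLHS](_ : _ = D * l * F y / dist x y `^ (Q - alpha))//; ring.
have K10 : 0 < K + 1 by lra.
apply: (@le_trans _ _ (\int[mu]_x ((K + 1)^-1%:E * G x))%E).
  apply: ge0_le_integral_nonmeas => x; first exact: poweR_ge0.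
  have qx0 := q_gt0 H E x.
  have q1 : 1 <= q x.
    rewrite -[leLHS]invr1 -[q x]invrK lef_pV2 ?posrE ?invr_gt0//.
    rewrite (q_inv E) lerBlDr.
    have : (p x)^-1 <= 1 by rewrite invf_le1// ltW// (p_gt1 E).
    have : 0 < alpha / Q by rewrite divr_gt0 ?(alpha_gt0 E)// (dim_gt0 H).
    lra.
  have rs0 : (0 <= riesz_sum dist mu Q alpha F x)%E.
    apply: zsum_ge0 => j; rewrite mule_ge0// ?lee_fin ?powR_ge0//.
    by apply: avg_ge0 => y; rewrite lee_fin.
  have Ki0 : 0 < (K + 1)^-1 by rewrite invr_gt0.
  apply: (@le_trans _ _ (((K + 1)^-1%:E * riesz_sum dist mu Q alpha F x) `^ q x)%E).
    apply: gt0_ler_poweR; rewrite ?in_itv/= ?leey ?andbT ?(ltW qx0)//.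
      by rewrite mule_ge0// lee_fin ltW.
    have Cl0 : 0 < (C * l)^-1 by rewrite invr_gt0 mulr_gt0.
    rewrite /vscale abseM [(`|((C * l)^-1)%:E|)%E]gee0_abs ?lee_fin ?(ltW Cl0)//.
    apply: (le_trans (lee_wpmul2r _ (bound x))); first by rewrite lee_fin ltW.
    rewrite muleAC -EFinM le_eqVlt; apply/orP; left; apply/eqP; congr (_%:E * _)%E.
    by rewrite /C; field; rewrite !gt_eqF.
  rewrite poweRM//; last by rewrite lee_fin ltW.
  apply: lee_pmul; rewrite ?poweR_ge0// poweR_EFin lee_fin.
  by rewrite ge1r_powR// Ki0 invf_le1//=; lra.
have G0 x : (0 <= G x)%E by exact: le_trans (poweR_ge0 _ _) (hG x).
rewrite ge0_integralZl//; last by rewrite lee_fin invr_ge0 ltW.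
apply: (le_trans (lee_wpmul2l _ IG)); first by rewrite lee_fin invr_ge0 ltW.
by rewrite -EFinM lee_fin ler_pdivrMl// mulr1; lra.
Qed.

End boundedness.

Theorem corollary1p5 (R : realType) (disp : measure_display)
    (X : measurableType disp) (dist : X -> X -> R)
    (mu : {measure set X -> \bar R}) (Q alpha : R) (x0 : X) (p q : X -> R)
    (hX : ahlfors_regular dist mu Q)
    (halpha : 0 < alpha < Q)
    (hp1 : forall x, 1 <= p x)
    (hpmeas : measurable_fun [set: X] p)
    (hpLH : LH dist x0 p)
    (hpess : [/\ (1 < ess_inf mu (EFin \o p))%E,
                 (ess_inf mu (EFin \o p) <= ess_sup mu (EFin \o p))%E &
                 (ess_sup mu (EFin \o p) < (Q / alpha)%:E)%E])
    (hq : forall x, 1 / p x - 1 / q x = alpha / Q) :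
  exists C : R, 0 < C /\
    forall f : X -> \bar R, vLebesgue mu (EFin \o p) f ->
      (vnorm mu (EFin \o q) (Istar dist mu Q alpha f)
         <= C%:E * vnorm mu (EFin \o p) f)%E /\
      (vnorm mu (EFin \o q) (Istarstar dist mu alpha f)
         <= C%:E * vnorm mu (EFin \o p) f)%E.
Proof.
have [A0 [C1 [C2 H]]] := ahlfors_regular_space hX.
case/andP: halpha => a0 aQ; case: hpess => hi _ hs.
have [s [pp [pinf [c0 [cinf E]]]]] := exponents_of_log_holder H a0 hpLH hi hs hq.
have C10 := lower_gt0 H.
have dist_gt0 x y : y <> x -> 0 < dist x y.
  move=> yx; rewrite lt_neqAle (dist_ge0 H) andbT eq_sym; apply/eqP.
  by move=> /(dist_eq0 H) e; apply: yx.
pose k1 x y := ((dist x y `^ (Q - alpha))%:E^-1)%E.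
pose k2 x y := ((dist x y `^ alpha)%:E / mu (qball dist x (dist x y)))%E.
have k1D x y : y <> x -> (`|k1 x y| <= (1 / dist x y `^ (Q - alpha))%:E)%E.
  move=> /dist_gt0 d0; rewrite /k1 inver gt_eqF ?powR_gt0//.
  by rewrite gee0_abs ?lee_fin ?invr_ge0 ?powR_ge0// div1r lexx.
(* The lower mass bound [C1 * r ^ Q] at [r = dist x y] compares this kernel with the first one. *)
have k2D x y : y <> x -> (`|k2 x y| <= (C1^-1 / dist x y `^ (Q - alpha))%:E)%E.
  move=> /dist_gt0 d0; rewrite /k2.
  have := mu_qball_ge H x d0; have := mu_qball_fin H x (dist x y).
  have := measure_ge0 mu (qball dist x (dist x y)).
  case: (mu _) => [m| |//] _ _ //; rewrite lee_fin => mge.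
  have dQ : 0 < C1 * dist x y `^ Q by rewrite mulr_gt0 ?powR_gt0.
  have m0 : 0 < m by exact: lt_le_trans mge.
  rewrite inver gt_eqF// -EFinM gee0_abs; last first.
    by rewrite lee_fin mulr_ge0 ?powR_ge0// invr_ge0 ltW.
  rewrite lee_fin.
  have -> : C1^-1 / dist x y `^ (Q - alpha) = dist x y `^ alpha / (C1 * dist x y `^ Q).
    rewrite powRB; last by apply/implyP => _; rewrite gt_eqF.
    by field; rewrite !gt_eqF ?powR_gt0.
  by rewrite ler_pM2l ?powR_gt0// lef_pV2 ?posrE.
have [K1 K10 h1] := kernel_operator_bounded H E hpmeas aQ ltr01 k1D.
have Ci0 : 0 < C1^-1 by rewrite invr_gt0.
have [K2 K20 h2] := kernel_operator_bounded H E hpmeas aQ Ci0 k2D.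
exists (K1 + K2); split; first exact: addr_gt0.
move=> f [mf _].
have n0 : (0 <= vnorm mu (EFin \o p) f)%E.
  by apply/ereal_infP => _ [l [l0 _] <-]; rewrite lee_fin ltW.
split.
- apply: (le_trans (h1 f mf)); apply: lee_wpmul2r => //.
  by rewrite lee_fin lerDl ltW.
- have -> : Istarstar dist mu alpha f = fun x => (\int[mu]_y (f y * k2 x y))%E.
    apply/funext => x; apply: eq_integral => y _; rewrite /k2 muleA//.
  apply: (le_trans (h2 f mf)); apply: lee_wpmul2r => //.
  by rewrite lee_fin lerDr ltW.
Qed.
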